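(* Let $P$ be a rational polygon all of whose vertices have algebraic coordinates. Then the billiard in $P$ has at most finitely many $\lambda$-stable periodic cylinders.
   Context: A polygon is rational if all its angles are rational multiples of $\pi$. For a polygon $P$ with sides labeled $1,\dots,d$, let $\Phi$ be its billiard map (collision to collision, specular reflection), in coordinates $(s,\theta)$ with $s$ arc length on $\partial P$ and $\theta\in(-\pi/2,\pi/2)$ the angle from the inward normal. For $\lambda>0$ let $R_\lambda(s,\theta)=(s,\lambda\theta)$ and $\Phi_\lambda:=R_\lambda\circ\Phi$ (pinball billiard for $\lambda\ne1$). A periodic cylinder is a maximal one-parameter family of parallel periodic orbits of $\Phi$ with the same itinerary (sequence of sides hit). A periodic orbit $q$ of $\Phi$ is $\lambda^{+}$-stable (resp. $\lambda^-$-stable) if there exist a strictly decreasing (resp. strictly increasing) sequence $\lambda_n\to1$ and periodic orbits $q_n$ of $\Phi_{\lambda_n}$ with the same itinerary as $q$ such that $q_n\to q$. A periodic cylinder is $\lambda$-stable if it contains a $\lambda^+$-stable periodic orbit and a $\lambda^-$-stable periodic orbit. *)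

(* Defs.v *)
From Stdlib Require Import Reals Lra List ZArith.
Open Scope R_scope.

Definition pt := (R * R)%type.
Definition vadd (a b : pt) : pt := (fst a + fst b, snd a + snd b).
Definition vsub (a b : pt) : pt := (fst a - fst b, snd a - snd b).
Definition vscale (c : R) (a : pt) : pt := (c * fst a, c * snd a).
Definition dot (a b : pt) : R := fst a * fst b + snd a * snd b.
Definition cross (a b : pt) : R := fst a * snd b - snd a * fst b.
Definition vnorm (a : pt) : R := sqrt (dot a a).

(** * Polygons.
    A polygon with [d] sides is given by its vertices [v 0, ..., v (d-1)],
    listed counterclockwise; indices are taken modulo [d].  Side [i] is the
    segment from vertex [i] to vertex [i+1]. *)
Definition vert (d : nat) (v : nat -> pt) (i : nat) : pt := v (Nat.modulo i d).
Definition edge_vec (d : nat) (v : nat -> pt) (i : nat) : pt :=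
  vsub (vert d v (S i)) (vert d v i).
Definition on_closed_side (d : nat) (v : nat -> pt) (i : nat) (p : pt) : Prop :=
  exists t, 0 <= t <= 1 /\ p = vadd (vert d v i) (vscale t (edge_vec d v i)).
Definition on_boundary (d : nat) (v : nat -> pt) (p : pt) : Prop :=
  exists i, (i < d)%nat /\ on_closed_side d v i p.

Definition simple_polygon (d : nat) (v : nat -> pt) : Prop :=
  (3 <= d)%nat /\
  (forall i, (i < d)%nat -> vert d v i <> vert d v (S i)) /\
  (forall i j p, (i < j < d)%nat ->
     on_closed_side d v i p -> on_closed_side d v j p ->
     (j = S i /\ p = vert d v j) \/ (i = 0%nat /\ j = pred d /\ p = vert d v 0)) /\
  sum_f_R0 (fun i => cross (vert d v i) (vert d v (S i))) (pred d) > 0.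

Definition interior_angle (d : nat) (v : nat -> pt) (i : nat) (alpha : R) : Prop :=
  let a := vsub (vert d v (S i)) (vert d v i) in
  let b := vsub (vert d v (i + d - 1)) (vert d v i) in
  0 < alpha < 2 * PI /\
  cos alpha * (vnorm a * vnorm b) = dot a b /\
  sin alpha * (vnorm a * vnorm b) = cross a b.

Definition rational_polygon (d : nat) (v : nat -> pt) : Prop :=
  forall i, (i < d)%nat -> exists alpha (p q : Z),
    interior_angle d v i alpha /\ (0 < q)%Z /\ alpha = IZR p / IZR q * PI.

Definition Zpoly_eval (l : list Z) (x : R) : R :=
  fold_right (fun c acc => IZR c + x * acc) 0 l.
Definition is_algebraic (x : R) : Prop :=
  exists l : list Z, (exists c, In c l /\ c <> 0%Z) /\ Zpoly_eval l x = 0.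
Definition algebraic_vertices (d : nat) (v : nat -> pt) : Prop :=
  forall i, (i < d)%nat -> is_algebraic (fst (v i)) /\ is_algebraic (snd (v i)).

(** * Phase space.
    A phase point is (side i, position t in (0,1) along side i, angle theta
    in (-pi/2, pi/2) of the outgoing velocity from the inward normal).
    (Position t is an affine reparametrisation of arc length s on side i.) *)
Record phase := mkPh { side : nat; pos : R; ang : R }.

Definition in_phase (d : nat) (x : phase) : Prop :=
  (side x < d)%nat /\ 0 < pos x < 1 /\ - (PI / 2) < ang x < PI / 2.

Definition ph_point (d : nat) (v : nat -> pt) (x : phase) : pt :=
  vadd (vert d v (side x)) (vscale (pos x) (edge_vec d v (side x))).
(** unit tangent and inward unit normal of side i (ccw orientation) *)
Definition tang (d : nat) (v : nat -> pt) (i : nat) : pt :=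
  vscale (/ vnorm (edge_vec d v i)) (edge_vec d v i).
Definition nrm (d : nat) (v : nat -> pt) (i : nat) : pt :=
  (- snd (tang d v i), fst (tang d v i)).
Definition out_dir (d : nat) (v : nat -> pt) (x : phase) : pt :=
  vadd (vscale (cos (ang x)) (nrm d v (side x)))
       (vscale (sin (ang x)) (tang d v (side x))).

(** [pinball_step d v lam x y] : y = Phi_lam x = R_lam (Phi x), where Phi is
    the billiard map (fly to the first boundary point hit, which must lie in
    the interior of a side, then reflect specularly).  The reflected velocity
    u' = u - 2 (u.n) n has u'.n = -(u.n) and u'.t = u.t, so its angle with the
    inward normal is atan (u.t / -(u.n)). *)
Definition pinball_step (d : nat) (v : nat -> pt) (lam : R) (x y : phase) : Prop :=
  in_phase d x /\ in_phase d y /\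
  exists tau, 0 < tau /\
    ph_point d v y = vadd (ph_point d v x) (vscale tau (out_dir d v x)) /\
    (forall s, 0 < s < tau ->
       ~ on_boundary d v (vadd (ph_point d v x) (vscale s (out_dir d v x)))) /\
    ang y = lam * atan (dot (out_dir d v x) (tang d v (side y))
                        / - dot (out_dir d v x) (nrm d v (side y))).

Definition is_periodic_orbit (d : nat) (v : nat -> pt) (lam : R)
  (x : nat -> phase) : Prop :=
  (forall k, pinball_step d v lam (x k) (x (S k))) /\
  exists n, (0 < n)%nat /\ forall k, x (k + n)%nat = x k.

Definition same_itinerary (x y : nat -> phase) : Prop :=
  forall k, side (x k) = side (y k).

Definition orbit_cv (xs : nat -> nat -> phase) (x : nat -> phase) : Prop :=
  forall k, Un_cv (fun m => pos (xs m k)) (pos (x k)) /\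
            Un_cv (fun m => ang (xs m k)) (ang (x k)).

Definition lam_plus_stable (d : nat) (v : nat -> pt) (q : nat -> phase) : Prop :=
  is_periodic_orbit d v 1 q /\
  exists (lams : nat -> R) (qs : nat -> nat -> phase),
    (forall m, 0 < lams m) /\ (forall m, lams (S m) < lams m) /\ Un_cv lams 1 /\
    (forall m, is_periodic_orbit d v (lams m) (qs m) /\ same_itinerary (qs m) q) /\
    orbit_cv qs q.

Definition lam_minus_stable (d : nat) (v : nat -> pt) (q : nat -> phase) : Prop :=
  is_periodic_orbit d v 1 q /\
  exists (lams : nat -> R) (qs : nat -> nat -> phase),
    (forall m, 0 < lams m) /\ (forall m, lams m < lams (S m)) /\ Un_cv lams 1 /\
    (forall m, is_periodic_orbit d v (lams m) (qs m) /\ same_itinerary (qs m) q) /\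
    orbit_cv qs q.

(** * Periodic cylinders.
    Parallel orbits with the same itinerary: same sides and same angles at
    every bounce; they are joined by a one-parameter family iff every
    interpolated orbit (positions interpolated affinely) is a periodic orbit. *)
Definition interp (x y : nat -> phase) (s : R) : nat -> phase :=
  fun k => mkPh (side (x k)) ((1 - s) * pos (x k) + s * pos (y k)) (ang (x k)).

Definition cyl_rel (d : nat) (v : nat -> pt) (x y : nat -> phase) : Prop :=
  is_periodic_orbit d v 1 x /\ is_periodic_orbit d v 1 y /\
  same_itinerary x y /\ (forall k, ang (x k) = ang (y k)) /\
  (forall s, 0 <= s <= 1 -> is_periodic_orbit d v 1 (interp x y s)).

Definition cylinder_of (d : nat) (v : nat -> pt) (x : nat -> phase) : phase -> Prop :=
  fun p => exists y k, cyl_rel d v x y /\ p = y k.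

Definition periodic_cylinder (d : nat) (v : nat -> pt) (C : phase -> Prop) : Prop :=
  exists x, is_periodic_orbit d v 1 x /\ forall p, C p <-> cylinder_of d v x p.

Definition contains_orbit (C : phase -> Prop) (q : nat -> phase) : Prop :=
  forall k, C (q k).

Definition lam_stable_cylinder (d : nat) (v : nat -> pt) (C : phase -> Prop) : Prop :=
  periodic_cylinder d v C /\
  (exists q, contains_orbit C q /\ lam_plus_stable d v q) /\
  (exists q, contains_orbit C q /\ lam_minus_stable d v q).

(* Main.v *)
(* Along an orbit near q, consecutive angles satisfy th(k+1) = lam (c(k) - th(k)), where c(k)
   depends only on the two sides hit and is a rational multiple of pi.  Taking alternating sums
   over a period of even length N: for q (lam = 1) the alternating sum of the c(k) vanishes, so
   for the nearby orbits (lam <> 1) that of the angles vanishes, and in the limit it vanishes for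
   q; there it equals N th(0) up to a rational multiple of pi, so the angles of q are rational.
   On the other hand, the unfolding of a periodic orbit of even length ends with a translation
   defined over the number field K generated by the vertices, so tan th(k) lies in K, hence
   exp(2 i th(k)) is a root of unity of bounded degree.  This leaves finitely many directions.
   Finally a cylinder is determined by a direction and a vertex met by its right boundary orbit.
   That c(k) depends only on the sides uses that a chord starting on the inner side of the polygon
   arrives on the inner side; this is shown with winding numbers. *)

From Stdlib Require Import Reals Ranalysis5 Lra Lia List ZArith.
From Stdlib Require Import FunctionalExtensionality Classical.
From mathcomp Require all_boot all_order all_algebra all_field complex Rstruct.
From mathcomp Require algebra_tactics.ring.
Require Import Defs.
Open Scope R_scope.

(** * Oriented angles *)

(** The definition of a step only forbids boundary points in the interior of the flight, and its
    [atan] sees the arriving direction modulo [PI]. A chord arriving from outside would shift c(k)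
    by [PI] modulo [2 * PI], so the side of arrival must be controlled before any recurrence for the
    angles can be written. Rationality of the angles alone bounds nothing: the denominators created
    by dividing by N may grow with the orbit. The field K depends on the polygon only and supplies
    the bound. A root of unity of order n has degree phi(n) over the rationals, and phi(n) <= B
    forces n to divide (2B)!, so one factorial [M] is a common denominator for all orbits. Each
    bounce reverses orientation, so the transverse displacement of a parallel orbit alternates in
    sign. An orbit is therefore followed over twice its period, and the parity of the flight enters
    the data that identify a cylinder. *)

Definition vneg (a : pt) : pt := (- fst a, - snd a).

Ltac pt_simpl :=
  repeat match goal with p : pt |- _ => destruct p end;
  unfold vadd, vsub, vscale, vneg, dot, cross in *; simpl in *.
Ltac pt_ring := pt_simpl; first [ring | f_equal; ring].

Lemma vnorm_nonneg a : 0 <= vnorm a.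
Proof. apply sqrt_pos. Qed.

Lemma dot_self_nonneg a : 0 <= dot a a.
Proof. pt_simpl; nra. Qed.

Lemma vnorm_sqr a : vnorm a * vnorm a = dot a a.
Proof. apply sqrt_sqrt, dot_self_nonneg. Qed.

Lemma vnorm_pos a : a <> (0, 0) -> 0 < vnorm a.
Proof.
intros H; apply sqrt_lt_R0.
destruct a as [x y]; unfold dot; simpl.
destruct (Req_dec x 0) as [->|hx]; [destruct (Req_dec y 0) as [->|hy]|]; [easy | nra | nra].
Qed.

Lemma vnorm_eq0 a : vnorm a = 0 -> a = (0, 0).
Proof.
intros H. destruct (Req_dec (fst a) 0) as [h1|h1]; [destruct (Req_dec (snd a) 0) as [h2|h2]|].
- destruct a; simpl in *; congruence.
- exfalso; assert (0 < vnorm a) by (apply vnorm_pos; intros ->; simpl in *; lra); lra.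
- exfalso; assert (0 < vnorm a) by (apply vnorm_pos; intros ->; simpl in *; lra); lra.
Qed.

Lemma vnorm_neg a : vnorm (vneg a) = vnorm a.
Proof. unfold vnorm; f_equal; pt_ring. Qed.

Lemma vnorm_scale c a : 0 <= c -> vnorm (vscale c a) = c * vnorm a.
Proof.
intros hc; unfold vnorm.
replace (dot (vscale c a) (vscale c a)) with ((c * c) * dot a a) by pt_ring.
rewrite sqrt_mult_alt by nra. now rewrite sqrt_square.
Qed.

Lemma lagrange a b :
  dot a b * dot a b + cross a b * cross a b = (vnorm a * vnorm b) * (vnorm a * vnorm b).
Proof.
replace ((vnorm a * vnorm b) * (vnorm a * vnorm b))
  with ((vnorm a * vnorm a) * (vnorm b * vnorm b)) by ring.
rewrite !vnorm_sqr; pt_ring.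
Qed.

(* [ang2 a b] is the oriented angle from [a] to [b]; the half-angle formula makes it
   continuous wherever [a], [b] are nonzero and not opposite, which is what [not_opp] says. *)
Definition ang2 (a b : pt) : R := 2 * atan (cross a b / (vnorm a * vnorm b + dot a b)).
Definition not_opp (a b : pt) : Prop := 0 < vnorm a * vnorm b + dot a b.

Lemma norm_add_dot_nonneg a b : 0 <= vnorm a * vnorm b + dot a b.
Proof.
pose proof (lagrange a b); pose proof (vnorm_nonneg a); pose proof (vnorm_nonneg b).
pose proof (Rmult_le_pos _ _ H0 H1). nra.
Qed.

Lemma not_opp_cross a b : cross a b <> 0 -> not_opp a b.
Proof.
intros H; pose proof (norm_add_dot_nonneg a b) as [h|h]; [exact h|].
pose proof (lagrange a b). exfalso.
assert (0 < cross a b * cross a b) by nra. nra.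
Qed.

Lemma not_opp_norm_pos a b : not_opp a b -> 0 < vnorm a * vnorm b.
Proof.
unfold not_opp; intros H.
pose proof (vnorm_nonneg a); pose proof (vnorm_nonneg b).
pose proof (Rmult_le_pos _ _ H0 H1) as [h|h]; [exact h|].
pose proof (lagrange a b). nra.
Qed.

(** Equality case of Cauchy-Schwarz: the squared norm of the combination is [2 * (vnorm a * vnorm b)
    * (vnorm a * vnorm b + dot a b)]. Zero vectors are included. *)
Lemma opp_vectors a b : ~ not_opp a b ->
  vadd (vscale (vnorm b) a) (vscale (vnorm a) b) = (0, 0).
Proof.
intros H. assert (E : vnorm a * vnorm b + dot a b = 0).
{ pose proof (norm_add_dot_nonneg a b); unfold not_opp in H; lra. }
apply vnorm_eq0. unfold vnorm at 1.
replace (dot _ _) with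
  (vnorm b * vnorm b * dot a a + vnorm a * vnorm a * dot b b + 2 * (vnorm a * vnorm b) * dot a b).
- rewrite <- !vnorm_sqr.
  replace (_ + _ + _) with (2 * (vnorm a * vnorm b) * (vnorm a * vnorm b + dot a b)) by ring.
  rewrite E, Rmult_0_r; apply sqrt_0.
- generalize (vnorm a) (vnorm b); intros; pt_ring.
Qed.

Lemma ang2_spec a b : not_opp a b ->
  cos (ang2 a b) * (vnorm a * vnorm b) = dot a b /\
  sin (ang2 a b) * (vnorm a * vnorm b) = cross a b.
Proof.
intros H. pose proof (not_opp_norm_pos _ _ H) as HL. unfold not_opp in H.
pose proof (lagrange a b) as Lg. unfold ang2.
set (L := vnorm a * vnorm b) in *. set (D := L + dot a b) in *.
set (C := cross a b) in *. set (y := atan (C / D)).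
assert (cy : 0 < cos y) by (destruct (atan_bound (C / D)); apply cos_gt_0; unfold y; lra).
assert (ty : sin y = C / D * cos y).
{ rewrite <- (tan_atan (C / D)); fold y; unfold tan; field; lra. }
(* Lagrange's identity gives [D * D + C * C = 2 * L * D], which fixes the squared cosine of the
   half-angle [y]. *)
assert (tr : cos y * cos y * (2 * L) = D).
{ pose proof (sin2_cos2 y) as h; unfold Rsqr in h; rewrite ty in h.
  assert (h' : cos y * cos y * (D * D + C * C) = D * D).
  { replace (D * D) with (D * D * 1) at 2 by ring. rewrite <- h; field; lra. }
  replace (D * D + C * C) with (2 * L * D) in h' by (unfold D; nra).
  apply (Rmult_eq_reg_r D); [|lra]. rewrite <- h'; ring. }
rewrite cos_2a, sin_2a, ty.
assert (cL : cos y * cos y = D / (2 * L)) by (rewrite <- tr; field; lra).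
split.
- transitivity (cos y * cos y * (D * D - C * C) / (D * D) * L); [field; lra|].
  replace (D * D - C * C) with (2 * dot a b * D) by (unfold D; nra).
  rewrite cL; field; lra.
- transitivity (2 * C / D * (cos y * cos y) * L); [field; lra|].
  rewrite cL; field; lra.
Qed.

Lemma ang2_scale_l c a b : 0 < c -> ang2 (vscale c a) b = ang2 a b.
Proof.
intros hc; unfold ang2. rewrite vnorm_scale by lra.
replace (cross (vscale c a) b) with (c * cross a b) by pt_ring.
replace (c * vnorm a * vnorm b + dot (vscale c a) b) with (c * (vnorm a * vnorm b + dot a b))
  by (replace (dot (vscale c a) b) with (c * dot a b) by pt_ring; ring).
do 2 f_equal. now rewrite Rdiv_mult_l_l by lra.
Qed.

Lemma ang2_scale_r c a b : 0 < c -> ang2 a (vscale c b) = ang2 a b.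
Proof.
intros hc; unfold ang2. rewrite vnorm_scale by lra.
replace (cross a (vscale c b)) with (c * cross a b) by pt_ring.
replace (vnorm a * (c * vnorm b) + dot a (vscale c b)) with (c * (vnorm a * vnorm b + dot a b))
  by (replace (dot a (vscale c b)) with (c * dot a b) by pt_ring; ring).
do 2 f_equal. now rewrite Rdiv_mult_l_l by lra.
Qed.

Lemma ang2_neg a b : ang2 (vneg a) (vneg b) = ang2 a b.
Proof.
unfold ang2. rewrite !vnorm_neg.
replace (cross (vneg a) (vneg b)) with (cross a b) by pt_ring.
replace (dot (vneg a) (vneg b)) with (dot a b) by pt_ring. reflexivity.
Qed.

Lemma ang2_cross0 a b : cross a b = 0 -> ang2 a b = 0.
Proof. intros H; unfold ang2; rewrite H, Rdiv_0_l, atan_0; ring. Qed.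

(** The jump of [ang2] when its second arm is reversed, as a function of the cross product; it is
    meant for nonzero arguments. *)
Definition turn (x : R) : R := if Rlt_dec 0 x then PI else - PI.

(** By Lagrange's identity the two denominators multiply to the square of [cross a b], so the
    tangent [x] of the half-angle becomes [- / x]. The half-angle changes by a quarter turn, the
    angle by [PI]. *)
Lemma ang2_flip a b : cross a b <> 0 -> ang2 a (vneg b) = ang2 a b - turn (cross a b).
Proof.
intros H. pose proof (not_opp_cross a b H) as h1.
assert (h2 : not_opp a (vneg b)).
{ apply not_opp_cross. replace (cross a (vneg b)) with (- cross a b) by pt_ring; lra. }
unfold not_opp in *; unfold ang2. rewrite vnorm_neg in *.
pose proof (lagrange a b) as Lg.
replace (cross a (vneg b)) with (- cross a b) in * by pt_ring.
replace (dot a (vneg b)) with (- dot a b) in * by pt_ring.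
set (L := vnorm a * vnorm b) in *. set (x := cross a b / (L + dot a b)).
assert (E : - cross a b / (L + - dot a b) = - / x).
{ unfold x. assert (E : cross a b * cross a b = (L + dot a b) * (L + - dot a b)) by nra.
  field_simplify_eq; [|lra]. nra. }
rewrite E, atan_opp. unfold turn.
destruct (Rlt_dec 0 (cross a b)) as [h|h].
- rewrite atan_inv by (unfold x; apply Rdiv_lt_0_compat; lra). lra.
- assert (hx : 0 < - x).
  { unfold x. rewrite <- Rdiv_opp_l. apply Rdiv_lt_0_compat; lra. }
  replace (/ x) with (- / - x) by (field; lra).
  rewrite atan_opp, atan_inv, atan_opp by lra. lra.
Qed.

Definition pcont (f : R -> pt) (s : R) : Prop :=
  continuity_pt (fun r => fst (f r)) s /\ continuity_pt (fun r => snd (f r)) s.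

Lemma pcont_affine a b s : pcont (fun r => vadd a (vscale r b)) s.
Proof.
split; unfold vadd, vscale; simpl; apply derivable_continuous_pt; reg.
Qed.

Lemma ang2_continuous f g s : pcont f s -> pcont g s -> not_opp (f s) (g s) ->
  continuity_pt (fun r => ang2 (f r) (g r)) s.
Proof.
intros [f1 f2] [g1 g2] H. unfold ang2.
assert (cn : forall h, pcont h s -> continuity_pt (fun r => vnorm (h r)) s).
{ intros h [h1 h2]. unfold vnorm.
  apply (continuity_pt_comp (fun r => dot (h r) (h r)) sqrt).
  - unfold dot. apply continuity_pt_plus; apply continuity_pt_mult; assumption.
  - apply continuity_pt_sqrt, dot_self_nonneg. }
apply continuity_pt_mult; [apply continuity_pt_const; now intros ? ?|].
apply (continuity_pt_comp (fun r => cross (f r) (g r) / (vnorm (f r) * vnorm (g r) + dot (f r) (g r))) atan).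
- apply continuity_pt_div; [| |unfold not_opp in H; lra].
  + unfold cross. apply continuity_pt_minus; apply continuity_pt_mult; assumption.
  + apply continuity_pt_plus; [apply continuity_pt_mult; apply cn; now split|].
    unfold dot. apply continuity_pt_plus; apply continuity_pt_mult; assumption.
- apply derivable_continuous_pt, derivable_pt_atan.
Qed.

Lemma sum_continuous (F : nat -> R -> R) n s :
  (forall k, (k <= n)%nat -> continuity_pt (F k) s) ->
  continuity_pt (fun r => sum_f_R0 (fun k => F k r) n) s.
Proof.
induction n as [|n IH]; intros H; simpl.
- apply H; lia.
- apply continuity_pt_plus; [apply IH; intros; apply H; lia | apply H; lia].
Qed.

(* The closing-up argument: turning from [z 0] by the successive oriented angles (with some
   of the arms reversed) ends on the line of [z (S n)]. *)
Lemma sum_ang2_sin (z : nat -> pt) (mode : nat -> bool) n :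
  (forall k, (k <= n)%nat -> not_opp (z k) (if mode k then vneg (z (S k)) else z (S k))) ->
  exists e, e * e = 1 /\
  let A := sum_f_R0 (fun k => ang2 (z k) (if mode k then vneg (z (S k)) else z (S k))) n in
  cos A * (vnorm (z 0%nat) * vnorm (z (S n))) = e * dot (z 0%nat) (z (S n)) /\
  sin A * (vnorm (z 0%nat) * vnorm (z (S n))) = e * cross (z 0%nat) (z (S n)).
Proof.
assert (one : forall k, not_opp (z k) (if mode k then vneg (z (S k)) else z (S k)) ->
  exists e, e * e = 1 /\
  let A := ang2 (z k) (if mode k then vneg (z (S k)) else z (S k)) in
  cos A * (vnorm (z k) * vnorm (z (S k))) = e * dot (z k) (z (S k)) /\
  sin A * (vnorm (z k) * vnorm (z (S k))) = e * cross (z k) (z (S k))).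
{ intros k H. destruct (ang2_spec _ _ H) as [h1 h2]. destruct (mode k).
  - exists (-1). rewrite vnorm_neg in h1, h2. split; [ring|]. cbv zeta. rewrite h1, h2.
    split; pt_ring.
  - exists 1. split; [ring|]. cbv zeta. rewrite h1, h2. split; ring. }
induction n as [|n IH]; intros H.
- apply (one 0%nat), H; lia.
- destruct IH as [e [he [hc hs]]]; [intros; apply H; lia|].
  pose proof (H (S n) (Nat.le_refl _)) as Hn.
  assert (nz : 0 < vnorm (z (S n)) * vnorm (z (S n))).
  { apply not_opp_norm_pos in Hn. pose proof (vnorm_nonneg (z (S n))).
    assert (vnorm (z (S n)) <> 0) by (intros E; rewrite E in Hn; lra). nra. }
  destruct (one (S n) Hn) as [e' [he' [hc' hs']]].
  exists (e * e'). split; [nra|]. cbv zeta in *. rewrite tech5, cos_plus, sin_plus.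
  set (A := sum_f_R0 _ n) in *. set (B := ang2 _ _) in *.
  set (N0 := vnorm (z 0%nat)) in *. set (N1 := vnorm (z (S n))) in *.
  set (N2 := vnorm (z (S (S n)))) in *.
  assert (d1 : N1 * N1 = dot (z (S n)) (z (S n))) by apply vnorm_sqr.
  split; apply (Rmult_eq_reg_r (N1 * N1)); try lra.
  + transitivity ((cos A * (N0 * N1)) * (cos B * (N1 * N2)) - (sin A * (N0 * N1)) * (sin B * (N1 * N2))); [ring|].
    rewrite hc, hs, hc', hs', d1. generalize (z 0%nat) (z (S n)) (z (S (S n))); intros; pt_ring.
  + transitivity ((sin A * (N0 * N1)) * (cos B * (N1 * N2)) + (cos A * (N0 * N1)) * (sin B * (N1 * N2))); [ring|].
    rewrite hc, hs, hc', hs', d1. generalize (z 0%nat) (z (S n)) (z (S (S n))); intros; pt_ring.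
Qed.

(** The zeros of [sin] are isolated: if the end values differed, the intermediate value theorem
    would give a value at distance [m] from [f 0] with [0 < m <= 1 < PI], where [sin] does not
    vanish. *)
Lemma sin0_constant (f : R -> R) :
  (forall s, 0 <= s <= 1 -> continuity_pt f s) ->
  (forall s, 0 <= s <= 1 -> sin (f s) = 0) -> f 0 = f 1.
Proof.
assert (key : forall f, (forall s, 0 <= s <= 1 -> continuity_pt f s) ->
  (forall s, 0 <= s <= 1 -> sin (f s) = 0) -> ~ f 0 < f 1).
{ clear f; intros f hc hs h.
  set (m := Rmin 1 ((f 1 - f 0) / 2)).
  assert (hm : 0 < m /\ m <= 1 /\ m < f 1 - f 0).
  { unfold m. repeat split; [apply Rmin_pos; lra | apply Rmin_l |].
    pose proof (Rmin_r 1 ((f 1 - f 0) / 2)); lra. }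
  destruct (IVT_interv (fun s => f s - (f 0 + m)) 0 1) as [s [hs1 hs2]]; try lra.
  - intros a ha. apply continuity_pt_minus; [now apply hc | apply continuity_pt_const; now intros ? ?].
  - assert (E : f s = f 0 + m) by lra.
    pose proof (hs s hs1) as e1. rewrite E, sin_plus, (hs 0) in e1 by lra.
    assert (0 < sin m) by (apply sin_gt_0; [lra | pose proof PI2_1; lra]).
    pose proof (sin2_cos2 (f 0)) as e2. rewrite (hs 0) in e2 by lra. unfold Rsqr in e2.
    assert (cos (f 0) = 0) by nra. rewrite H0 in e2. lra. }
intros hc hs. destruct (Rtotal_order (f 0) (f 1)) as [h|[h|h]]; [|exact h|]; exfalso.
- now apply (key f).
- apply (key (fun s => - f s)); [| |lra].
  + intros s h'. now apply continuity_pt_opp, hc.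
  + intros s h'. rewrite sin_neg, hs by lra. ring.
Qed.

Lemma sum_change (f g : nat -> R) j n : (j <= n)%nat ->
  (forall k, (k <= n)%nat -> k <> j -> f k = g k) ->
  sum_f_R0 f n - sum_f_R0 g n = f j - g j.
Proof.
revert j. induction n as [|n IH]; intros j hj H.
- replace j with 0%nat by lia. reflexivity.
- simpl. destruct (Nat.eq_dec j (S n)) as [->|hn].
  + rewrite (sum_eq f g n) by (intros; apply H; lia). ring.
  + assert (f (S n) = g (S n)) by (apply H; lia).
    assert (sum_f_R0 f n - sum_f_R0 g n = f j - g j) by (apply IH; [lia | intros; apply H; lia]).
    lra.
Qed.

(** * The inner side of a simple polygon *)

Lemma convex_open lo hi a b s : lo < a < hi -> lo < b < hi -> 0 <= s <= 1 -> lo < a + s * (b - a) < hi.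
Proof.
intros ha hb hs. destruct (Rle_dec a b).
- assert (0 <= s * (b - a)) by (apply Rmult_le_pos; lra).
  assert (0 <= (1 - s) * (b - a)) by (apply Rmult_le_pos; lra). lra.
- assert (0 <= s * (a - b)) by (apply Rmult_le_pos; lra).
  assert (0 <= (1 - s) * (a - b)) by (apply Rmult_le_pos; lra). lra.
Qed.

Section Polygon.
Variables (d : nat) (v : nat -> pt).
Hypothesis Hsimple : simple_polygon d v.

Definition side_point (i : nat) (t : R) : pt :=
  vadd (vert d v i) (vscale t (edge_vec d v i)).

Lemma vert_S i : vert d v (S i) = vadd (vert d v i) (edge_vec d v i).
Proof. unfold edge_vec. generalize (vert d v i) (vert d v (S i)); intros; pt_simpl; f_equal; ring. Qed.

Lemma vert_d : vert d v d = vert d v 0.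
Proof.
destruct Hsimple as [h _]. unfold vert. rewrite Nat.Div0.mod_same, Nat.Div0.mod_0_l. reflexivity.
Qed.

Lemma edge_nz i : (i < d)%nat -> edge_vec d v i <> (0, 0).
Proof.
intros hi E. destruct Hsimple as [_ [h _]]. apply (h i hi).
rewrite vert_S, E. destruct (vert d v i); unfold vadd; simpl; f_equal; ring.
Qed.

Lemma side_point_inj i t t' : (i < d)%nat -> side_point i t = side_point i t' -> t = t'.
Proof.
intros hi E. pose proof (edge_nz i hi) as h. unfold side_point in E.
destruct (edge_vec d v i) as [x y], (vert d v i) as [a b].
unfold vadd, vscale in E; simpl in E. injection E as E1 E2.
destruct (Req_dec x 0) as [->|hx]; [destruct (Req_dec y 0) as [->|hy]|]; [easy | |].
- apply (Rmult_eq_reg_r y); lra.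
- apply (Rmult_eq_reg_r x); lra.
Qed.

Lemma vert_side0 i : vert d v i = side_point i 0.
Proof. unfold side_point; destruct (vert d v i), (edge_vec d v i); unfold vadd, vscale; simpl; f_equal; ring. Qed.

Lemma vert_side1 i : vert d v (S i) = side_point i 1.
Proof. rewrite vert_S; unfold side_point; destruct (vert d v i), (edge_vec d v i); unfold vadd, vscale; simpl; f_equal; ring. Qed.

Lemma open_side_disjoint i k t : (i < d)%nat -> (k < d)%nat -> i <> k -> 0 < t < 1 ->
  ~ on_closed_side d v k (side_point i t).
Proof.
intros hi hk ne ht H.
assert (Hi : on_closed_side d v i (side_point i t)) by (exists t; split; [lra | reflexivity]).
destruct Hsimple as [h3 [_ [h _]]].
destruct (Nat.lt_total i k) as [l|[l|l]]; [| lia |].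
- destruct (h i k _ (conj l hk) Hi H) as [[E1 E2]|[E1 [E2 E3]]].
  + subst k. rewrite vert_side1 in E2. apply side_point_inj in E2; [lra | lia].
  + subst i. rewrite vert_side0 in E3. apply side_point_inj in E3; [lra | lia].
- destruct (h k i _ (conj l hi) H Hi) as [[E1 E2]|[E1 [E2 E3]]].
  + rewrite vert_side0 in E2. apply side_point_inj in E2; [lra | lia].
  + rewrite <- vert_d in E3. replace d with (S i) in E3 at 2 by lia.
    rewrite vert_side1 in E3. apply side_point_inj in E3; [lra | lia].
Qed.

(** If the arms from [p] to the two ends are opposite, [p] divides the side in the ratio of their
    lengths; if both vanish, [p] is an end. *)
Lemma not_opp_off_side p k :
  ~ on_closed_side d v k p -> not_opp (vsub (vert d v k) p) (vsub (vert d v (S k)) p).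
Proof.
intros H. destruct (Rlt_dec 0 (vnorm (vsub (vert d v k) p) * vnorm (vsub (vert d v (S k)) p)
  + dot (vsub (vert d v k) p) (vsub (vert d v (S k)) p))) as [h|h]; [exact h|].
exfalso; apply H. apply opp_vectors in h.
set (a := vsub (vert d v k) p) in *. set (b := vsub (vert d v (S k)) p) in *.
pose proof (vnorm_nonneg a); pose proof (vnorm_nonneg b).
destruct (Req_dec (vnorm a + vnorm b) 0) as [E|E].
- assert (Ea : vnorm a = 0) by lra. apply vnorm_eq0 in Ea.
  exists 0; split; [lra|]. unfold a in Ea.
  destruct (vert d v k), p, (edge_vec d v k); unfold vsub, vadd, vscale in *; simpl in *.
  injection Ea; intros; f_equal; lra.
- exists (vnorm a / (vnorm a + vnorm b)). split.
  + split.
    * apply Rmult_le_pos; [lra | left; apply Rinv_0_lt_compat; lra].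
    * apply (Rmult_le_reg_r (vnorm a + vnorm b)); [lra|]. field_simplify; lra.
  + assert (Hb : vadd a (edge_vec d v k) = b).
    { unfold a, b. rewrite vert_S. generalize (vert d v k) (edge_vec d v k); intros; pt_simpl; f_equal; ring. }
    assert (Ha : vadd p a = vert d v k).
    { unfold a. generalize (vert d v k); intros; pt_simpl; f_equal; ring. }
    rewrite <- Ha. rewrite <- Hb in h at 2. rewrite <- Hb in E at 1. rewrite <- Hb.
    rewrite Hb in E. rewrite Hb. clearbody a b. set (na := vnorm a) in *; set (nb := vnorm b) in *.
    clearbody na nb. destruct p as [p1 p2], a as [a1 a2], (edge_vec d v k) as [e1 e2].
    unfold vadd, vscale in *; simpl in *. injection h; intros h2 h1. f_equal; field_simplify_eq; lra.
Qed.

(** The angle swept by the boundary as seen from [p]. When [p] crosses side [k], the two arms of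
    that side become opposite and its term jumps; reversing the far arm, where [mode k] holds, keeps
    the term continuous there at the price of a shift by [PI]. *)
Definition turning (mode : nat -> bool) (p : pt) : R :=
  sum_f_R0 (fun k => ang2 (vsub (vert d v k) p)
    (if mode k then vneg (vsub (vert d v (S k)) p) else vsub (vert d v (S k)) p)) (pred d).

Definition turn_ok (mode : nat -> bool) (p : pt) : Prop :=
  forall k, (k < d)%nat -> not_opp (vsub (vert d v k) p)
    (if mode k then vneg (vsub (vert d v (S k)) p) else vsub (vert d v (S k)) p).

Lemma turning_sin mode p : turn_ok mode p -> sin (turning mode p) = 0.
Proof.
intros H. destruct Hsimple as [h3 _].
destruct (sum_ang2_sin (fun k => vsub (vert d v k) p) mode (pred d)) as [e [he [_ hs]]].
{ intros k hk. apply H; lia. }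
cbv zeta in hs. replace (S (pred d)) with d in hs by lia. rewrite vert_d in hs.
set (z := vsub (vert d v 0) p) in *.
assert (nz : 0 < vnorm z).
{ assert (h := H 0%nat ltac:(lia)). apply not_opp_norm_pos in h. fold z in h.
  pose proof (vnorm_nonneg z). destruct H0 as [h0|h0]; [exact h0 | rewrite <- h0 in h; lra]. }
replace (cross z z) with 0 in hs by (generalize z; intros; pt_simpl; ring).
unfold turning. apply (Rmult_eq_reg_r (vnorm z * vnorm z)); [|nra]. lra.
Qed.

Lemma turning_continuous mode a b s : turn_ok mode (vadd a (vscale s b)) ->
  continuity_pt (fun r => turning mode (vadd a (vscale r b))) s.
Proof.
intros H. unfold turning. destruct Hsimple as [h3 _].
apply (sum_continuous (fun k r => ang2 (vsub (vert d v k) (vadd a (vscale r b)))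
    (if mode k then vneg (vsub (vert d v (S k)) (vadd a (vscale r b)))
     else vsub (vert d v (S k)) (vadd a (vscale r b))))).
intros k hk.
assert (c : forall w, pcont (fun r => vsub w (vadd a (vscale r b))) s).
{ intros w; split; unfold vadd, vsub, vscale; simpl; apply derivable_continuous_pt; reg. }
apply ang2_continuous; [apply c | | apply H; lia].
destruct (mode k); [|apply c].
split; unfold vneg, vadd, vsub, vscale; simpl; apply derivable_continuous_pt; reg.
Qed.

Lemma turning_segment mode a b :
  (forall s, 0 <= s <= 1 -> turn_ok mode (vadd a (vscale s (vsub b a)))) ->
  turning mode a = turning mode b.
Proof.
intros H.
pose proof (sin0_constant (fun s => turning mode (vadd a (vscale s (vsub b a))))
  (fun s hs => turning_continuous mode _ _ s (H s hs)) (fun s hs => turning_sin mode _ (H s hs))) as E.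
cbv beta in E. replace (vadd a (vscale 0 (vsub b a))) with a in E by (pt_simpl; f_equal; ring).
replace (vadd a (vscale 1 (vsub b a))) with b in E by (pt_simpl; f_equal; ring). exact E.
Qed.

Definition at_side (i k : nat) : bool := Nat.eqb k i.

Lemma turn_ok_side i t : (i < d)%nat -> 0 < t < 1 -> turn_ok (at_side i) (side_point i t).
Proof.
intros hi ht k hk. unfold at_side. destruct (Nat.eqb_spec k i) as [->|ne].
- rewrite vert_S. unfold side_point.
  pose proof (vnorm_pos _ (edge_nz i hi)) as he.
  assert (0 < dot (edge_vec d v i) (edge_vec d v i)) by (rewrite <- vnorm_sqr; nra).
  unfold not_opp. revert H. generalize (vert d v i) (edge_vec d v i). intros a e He.
  replace (dot _ _) with (t * (1 - t) * dot e e) by (pt_simpl; ring).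
  match goal with |- 0 < ?x * ?y + _ => pose proof (vnorm_nonneg (vsub a (vadd a (vscale t e))));
    assert (0 <= x * y) by (apply Rmult_le_pos; apply vnorm_nonneg) end.
  assert (h1 : 0 < t * (1 - t)) by (apply Rmult_lt_0_compat; lra). pose proof (Rmult_lt_0_compat _ _ h1 He). lra.
- apply not_opp_off_side, open_side_disjoint; auto.
Qed.

Lemma turning_side_const i t t' : (i < d)%nat -> 0 < t < 1 -> 0 < t' < 1 ->
  turning (at_side i) (side_point i t) = turning (at_side i) (side_point i t').
Proof.
intros hi ht ht'. apply turning_segment. intros s hs.
replace (vadd _ _) with (side_point i (t + s * (t' - t))).
- apply turn_ok_side; [exact hi | now apply convex_open].
- unfold side_point. generalize (vert d v i) (edge_vec d v i); intros; pt_simpl; f_equal; ring.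
Qed.

Lemma corner_off_side i k : (S i < d)%nat -> (k < d)%nat -> k <> i -> k <> S i ->
  ~ on_closed_side d v k (vert d v (S i)).
Proof.
intros hi hk n1 n2 H. destruct Hsimple as [h3 [ve [h _]]].
destruct (Nat.lt_total k i) as [l|[l|l]]; [| lia |].
- assert (Hi : on_closed_side d v i (vert d v (S i))).
  { exists 1; split; [lra|]. apply vert_side1. }
  destruct (h k i _ ltac:(lia) H Hi) as [[E1 E2]|[E1 [E2 E3]]]; [|lia].
  apply (ve i); [lia | congruence].
- assert (Hi : on_closed_side d v (S i) (vert d v (S i))).
  { exists 0; split; [lra|]. apply vert_side0. }
  destruct (h (S i) k _ ltac:(lia) Hi H) as [[E1 E2]|[E1 [E2 E3]]]; [|lia].
  subst k. apply (ve (S i)); [lia | congruence].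
Qed.

(** If the second edge folded back along the first, the sides would overlap near their common
    vertex: the point at distance [m * vnorm a * vnorm b] from it would lie on both. *)
Lemma corner_not_opp i : (S i < d)%nat -> not_opp (edge_vec d v i) (edge_vec d v (S i)).
Proof.
intros hi. destruct (Rlt_dec 0 (vnorm (edge_vec d v i) * vnorm (edge_vec d v (S i))
  + dot (edge_vec d v i) (edge_vec d v (S i)))) as [h|h]; [exact h|].
exfalso. apply opp_vectors in h.
set (a := edge_vec d v i) in *. set (b := edge_vec d v (S i)) in *.
assert (na : 0 < vnorm a) by (apply vnorm_pos, edge_nz; lia).
assert (nb : 0 < vnorm b) by (apply vnorm_pos, edge_nz; lia).
set (m := Rmin (/ vnorm a) (/ vnorm b)).
assert (hm : 0 < m /\ m * vnorm a <= 1 /\ m * vnorm b <= 1).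
{ unfold m. pose proof (Rinv_0_lt_compat _ na); pose proof (Rinv_0_lt_compat _ nb).
  split; [apply Rmin_pos; lra|]. split.
  - apply Rle_trans with (/ vnorm a * vnorm a); [apply Rmult_le_compat_r; [lra | apply Rmin_l] | right; field; lra].
  - apply Rle_trans with (/ vnorm b * vnorm b); [apply Rmult_le_compat_r; [lra | apply Rmin_r] | right; field; lra]. }
assert (p1 : on_closed_side d v i (side_point i (1 - m * vnorm b))).
{ exists (1 - m * vnorm b); split; [nra | reflexivity]. }
assert (p2 : on_closed_side d v (S i) (side_point i (1 - m * vnorm b))).
{ exists (m * vnorm a); split; [nra|]. rewrite vert_S. unfold side_point. fold a b.
  generalize dependent (vnorm a). generalize dependent (vnorm b). intros nb' h; intros.
  generalize (vert d v i); intros w. destruct a, b, w; unfold vadd, vscale in *; simpl in *.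
  injection h0; intros h2 h1. f_equal; nra. }
destruct Hsimple as [h3 [ve [hd _]]].
destruct (hd i (S i) _ ltac:(lia) p1 p2) as [[E1 E2]|[E1 [E2 E3]]]; [|lia].
rewrite vert_side1 in E2. apply side_point_inj in E2; [nra | lia].
Qed.

End Polygon.

(** * The winding angle seen from the boundary *)

Section Sides.
Variables (d : nat) (v : nat -> pt).
Hypothesis Hsimple : simple_polygon d v.

Let E := edge_vec d v.
Let V := vert d v.
Let W := turning d v.

Lemma small_parameter (f : R -> R) : continuity_pt f 0 -> f 0 = 0 ->
  exists eps, 0 < eps < 1 /\ Rabs (f eps) < 1.
Proof.
intros hc h0. destruct (hc 1 ltac:(lra)) as [al [hal H]].
assert (hm : 0 < Rmin (al / 2) (1 / 2)) by (apply Rmin_pos; lra).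
pose proof (Rmin_l (al / 2) (1 / 2)); pose proof (Rmin_r (al / 2) (1 / 2)).
exists (Rmin (al / 2) (1 / 2)). split; [lra|].
specialize (H (Rmin (al / 2) (1 / 2))). simpl in H. unfold Rdist in H.
rewrite h0, !Rminus_0_r in H. apply H. split.
- split; [exact I | lra].
- rewrite Rabs_right; lra.
Qed.

(* Both one-sided values tend, at the common vertex, to the same expression: the exterior
   angle [ang2 (E i) (E (S i))] plus the contributions of the other sides. *)
Lemma turning_adjacent i : (S i < d)%nat ->
  W (at_side i) (side_point d v i (1 / 2)) = W (at_side (S i)) (side_point d v (S i) (1 / 2)).
Proof.
intros hi.
set (P := fun r : R => vadd (V (S i)) (vscale r (vneg (E i)))).
set (Q := fun r : R => vadd (V (S i)) (vscale r (E (S i)))).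
assert (PE : forall r, P r = side_point d v i (1 - r)).
{ intros r. unfold P, V. rewrite vert_S. unfold side_point, E.
  generalize (vert d v i) (edge_vec d v i); intros; pt_simpl; f_equal; ring. }
assert (QE : forall r, Q r = side_point d v (S i) r) by reflexivity.
(* [H k r] is the difference of the [k]-th terms of the two sums at [P r] and [Q r]. For the two
   sides at the corner one term is zero and the vanishing arm of the other is rescaled to unit
   order, so that [H k] is continuous at [r = 0]. *)
set (H := fun (k : nat) (r : R) =>
  if Nat.eqb k i then - ang2 (vadd (vneg (E i)) (vscale r (vneg (E (S i))))) (vneg (E (S i)))
  else if Nat.eqb k (S i) then ang2 (E i) (vadd (E (S i)) (vscale r (E i)))
  else ang2 (vsub (V k) (P r)) (vsub (V (S k)) (P r)) - ang2 (vsub (V k) (Q r)) (vsub (V (S k)) (Q r))).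
assert (cno := corner_not_opp d v Hsimple i hi). fold (E i) (E (S i)) in cno.
assert (Hc : continuity_pt (fun r => sum_f_R0 (fun k => H k r) (pred d)) 0).
{ apply sum_continuous. intros k hk. unfold H.
  destruct (Nat.eqb_spec k i) as [->|n1]; [|destruct (Nat.eqb_spec k (S i)) as [->|n2]].
  - apply continuity_pt_opp. apply ang2_continuous.
    + apply pcont_affine.
    + split; apply continuity_pt_const; now intros ? ?.
    + replace (vadd (vneg (E i)) (vscale 0 (vneg (E (S i))))) with (vneg (E i))
        by (generalize (E i) (E (S i)); intros; pt_simpl; f_equal; ring).
      unfold not_opp in *. rewrite !vnorm_neg.
      replace (dot (vneg (E i)) (vneg (E (S i)))) with (dot (E i) (E (S i))); [exact cno|].
      generalize (E i) (E (S i)); intros; pt_ring.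
  - apply ang2_continuous.
    + split; apply continuity_pt_const; now intros ? ?.
    + apply pcont_affine.
    + replace (vadd (E (S i)) (vscale 0 (E i))) with (E (S i)); [exact cno|].
      generalize (E i) (E (S i)); intros; pt_simpl; f_equal; ring.
  - assert (off : ~ on_closed_side d v k (V (S i))) by (apply corner_off_side; auto; lia).
    assert (c : forall w b, pcont (fun r => vsub w (vadd (V (S i)) (vscale r b))) 0).
    { intros w b; split; unfold vadd, vsub, vscale; simpl; apply derivable_continuous_pt; reg. }
    assert (z : forall b, vadd (V (S i)) (vscale 0 b) = V (S i)).
    { intros b; generalize (V (S i)); intros; pt_simpl; f_equal; ring. }
    apply continuity_pt_minus; apply ang2_continuous; try apply c;
      unfold P, Q; rewrite z; apply not_opp_off_side; exact off. }
assert (H0 : sum_f_R0 (fun k => H k 0) (pred d) = 0).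
{ assert (P0 : P 0 = V (S i)) by (unfold P; generalize (V (S i)); intros; pt_simpl; f_equal; ring).
  assert (Q0 : Q 0 = V (S i)) by (unfold Q; generalize (V (S i)); intros; pt_simpl; f_equal; ring).
  set (G := fun k => if Nat.eqb k (S i) then H (S i) 0 else 0).
  assert (s2 : sum_f_R0 G (pred d) = H (S i) 0).
  { pose proof (sum_change G (fun _ => 0) (S i) (pred d) ltac:(lia)) as s2.
    rewrite sum_cte in s2. unfold G in s2 at 3. rewrite Nat.eqb_refl in s2.
    assert (s3 : sum_f_R0 G (pred d) - 0 * INR (S (pred d)) = H (S i) 0 - 0); [|lra].
    apply s2. intros k _ hk. unfold G. destruct (Nat.eqb_spec k (S i)); [lia | reflexivity]. }
  assert (s1 : sum_f_R0 (fun k => H k 0) (pred d) - sum_f_R0 G (pred d) = H i 0 - G i).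
  { apply (sum_change (fun k => H k 0) G i (pred d)); [lia|].
    intros k hk n1. unfold G. destruct (Nat.eqb_spec k (S i)) as [->|n2]; [reflexivity|].
    unfold H. destruct (Nat.eqb_spec k i) as [|_]; [lia|]. destruct (Nat.eqb_spec k (S i)) as [|_]; [lia|].
    rewrite P0, Q0. ring. }
  assert (Hi : H i 0 = - H (S i) 0).
  { unfold H. rewrite !Nat.eqb_refl.
    replace (Nat.eqb (S i) i) with false by (symmetry; apply Nat.eqb_neq; lia).
    replace (vadd (vneg (E i)) (vscale 0 (vneg (E (S i))))) with (vneg (E i))
        by (generalize (E i) (E (S i)); intros; pt_simpl; f_equal; ring).
    replace (vadd (E (S i)) (vscale 0 (E i))) with (E (S i))
        by (generalize (E i) (E (S i)); intros; pt_simpl; f_equal; ring).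
    now rewrite ang2_neg. }
  assert (Gi : G i = 0) by (unfold G; destruct (Nat.eqb_spec i (S i)); [lia | reflexivity]).
  lra. }
destruct (small_parameter _ Hc H0) as [r [hr Hr]].
assert (S1 : sum_f_R0 (fun k => H k r) (pred d) = W (at_side i) (P r) - W (at_side (S i)) (Q r)).
{ unfold W, turning. rewrite <- minus_sum. apply sum_eq. intros k hk. unfold H, at_side.
  fold V. destruct (Nat.eqb_spec k i) as [->|n1]; [|destruct (Nat.eqb_spec k (S i)) as [->|n2]].
  - replace (Nat.eqb i (S i)) with false by (symmetry; apply Nat.eqb_neq; lia).
    rewrite (ang2_cross0 (vsub (V i) (P r)) _).
    2: { unfold P, V. rewrite vert_S. unfold E. generalize (vert d v i) (edge_vec d v i); intros; pt_simpl; ring. }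
    replace (vsub (V i) (Q r)) with (vadd (vneg (E i)) (vscale r (vneg (E (S i))))).
    2: { unfold Q, V. rewrite vert_S. fold (E i). generalize (vert d v i) (E i) (E (S i)); intros; pt_simpl; f_equal; ring. }
    replace (vsub (V (S i)) (Q r)) with (vscale r (vneg (E (S i)))).
    2: { unfold Q. generalize (V (S i)) (E (S i)); intros; pt_simpl; f_equal; ring. }
    rewrite ang2_scale_r by lra. ring.
  - rewrite (ang2_cross0 (vsub (V (S i)) (Q r)) _).
    2: { unfold Q, V. rewrite (vert_S d v (S i)). fold (E (S i)).
         generalize (vert d v (S i)) (E (S i)); intros; pt_simpl; ring. }
    replace (vsub (V (S i)) (P r)) with (vscale r (E i)).
    2: { unfold P. generalize (V (S i)) (E i); intros; pt_simpl; f_equal; ring. }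
    replace (vsub (V (S (S i))) (P r)) with (vadd (E (S i)) (vscale r (E i))).
    2: { unfold P, V. rewrite (vert_S d v (S i)). fold (E (S i)).
         generalize (vert d v (S i)) (E (S i)) (E i); intros; pt_simpl; f_equal; ring. }
    rewrite ang2_scale_l by lra. ring.
  - ring. }
rewrite S1, PE, QE in Hr.
assert (sP := turning_sin d v Hsimple _ _ (turn_ok_side d v Hsimple i (1 - r) ltac:(lia) ltac:(lra))).
assert (sQ := turning_sin d v Hsimple _ _ (turn_ok_side d v Hsimple (S i) r hi ltac:(lra))).
unfold W in *.
rewrite (turning_side_const d v Hsimple i (1 / 2) (1 - r)), (turning_side_const d v Hsimple (S i) (1 / 2) r) by (lia || lra).
set (a := turning d v (at_side i) _) in *. set (b := turning d v (at_side (S i)) _) in *.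
(* Both values are multiples of [PI], and they differ by less than 1. *)
assert (sab : sin (a - b) = 0) by (rewrite sin_minus, sP, sQ; ring).
apply Rabs_def2 in Hr. pose proof PI2_1.
destruct (Rtotal_order (a - b) 0) as [h|[h|h]]; [|lra|].
- pose proof (sin_lt_0_var (a - b)); lra.
- pose proof (sin_gt_0 (a - b)); lra.
Qed.

Lemma turning_common i j t t' : (i < d)%nat -> (j < d)%nat -> 0 < t < 1 -> 0 < t' < 1 ->
  W (at_side i) (side_point d v i t) = W (at_side j) (side_point d v j t').
Proof.
assert (all : forall k, (k < d)%nat ->
  W (at_side k) (side_point d v k (1 / 2)) = W (at_side 0) (side_point d v 0 (1 / 2))).
{ induction k as [|k IH]; intros hk; [reflexivity|].
  rewrite <- turning_adjacent by lia. apply IH; lia. }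
intros hi hj ht ht'. unfold W in *.
rewrite (turning_side_const d v Hsimple i t (1 / 2)), (turning_side_const d v Hsimple j t' (1 / 2)) by (auto; lra).
now rewrite (all i), (all j).
Qed.

(* Along the chord the winding number is constant; it jumps by half a turn at each end, with a sign
   telling on which side of the boundary the chord lies. *)
Lemma chord_sides i j t t' : (i < d)%nat -> (j < d)%nat -> i <> j -> 0 < t < 1 -> 0 < t' < 1 ->
  let P := side_point d v i t in let U := vsub (side_point d v j t') P in
  (forall s, 0 < s < 1 -> ~ on_boundary d v (vadd P (vscale s U))) ->
  cross (E i) U <> 0 -> cross (E j) U <> 0 ->
  0 < cross (E i) U -> cross (E j) U < 0.
Proof.
intros hi hj ne ht ht' P U clear ci cj pos.
set (Q := side_point d v j t') in *.
(* With the arms of both end sides reversed the sum is continuous on the closed chord. At either end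
   it differs from the boundary value there by the flip of the side at the other end. *)
set (md := fun k => orb (at_side i k) (at_side j k)).
assert (eqPQ : W md P = W md Q).
{ apply turning_segment; [exact Hsimple|]. fold U. intros s hs k hk.
  assert (off : k <> i -> k <> j -> ~ on_closed_side d v k (vadd P (vscale s U))).
  { intros n1 n2. destruct (Req_dec s 0) as [->|n3]; [|destruct (Req_dec s 1) as [->|n4]].
    - replace (vadd P (vscale 0 U)) with P by (generalize P U; intros; pt_simpl; f_equal; ring).
      apply open_side_disjoint; auto.
    - replace (vadd P (vscale 1 U)) with Q by (unfold U; generalize P Q; intros; pt_simpl; f_equal; ring).
      apply open_side_disjoint; auto.
    - intros H. apply (clear s); [lra | now exists k]. }
  unfold md, at_side. destruct (Nat.eqb_spec k i) as [->|n1]; [|destruct (Nat.eqb_spec k j) as [->|n2]]; simpl.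
  - destruct (Req_dec s 0) as [->|n3].
    + replace (vadd P (vscale 0 U)) with P by (generalize P U; intros; pt_simpl; f_equal; ring).
      pose proof (turn_ok_side d v Hsimple i t hi ht i hi) as h. unfold at_side in h.
      rewrite Nat.eqb_refl in h. exact h.
    + apply not_opp_cross. rewrite vert_S. fold (E i).
      replace (cross _ _) with (- (s * cross (E i) U)).
      * intros h. apply ci. apply (Rmult_eq_reg_l s); [lra | exact n3].
      * unfold P, side_point. fold (E i). generalize (vert d v i) (E i) U; intros; pt_simpl; ring.
  - destruct (Req_dec s 1) as [->|n3].
    + replace (vadd P (vscale 1 U)) with Q by (unfold U; generalize P Q; intros; pt_simpl; f_equal; ring).
      pose proof (turn_ok_side d v Hsimple j t' hj ht' j hj) as h. unfold at_side in h.
      rewrite Nat.eqb_refl in h. exact h.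
    + apply not_opp_cross. rewrite vert_S. fold (E j).
      replace (cross _ _) with ((1 - s) * cross (E j) U).
      * intros h. apply cj. apply (Rmult_eq_reg_l (1 - s)); [lra | lra].
      * replace (vadd P (vscale s U)) with (vadd Q (vscale (s - 1) U))
          by (unfold U; generalize P Q; intros; pt_simpl; f_equal; ring).
        unfold Q, side_point. fold (E j). generalize (vert d v j) (E j) U; intros; pt_simpl; ring.
  - apply not_opp_off_side, off; auto. }
assert (c1 : cross (vsub (vert d v j) P) (vsub (vert d v (S j)) P) = - cross (E j) U).
{ rewrite vert_S. fold (E j). unfold U, Q, side_point. fold (E j).
  generalize (vert d v j) (E j) P; intros; pt_simpl; ring. }
assert (c2 : cross (vsub (vert d v i) Q) (vsub (vert d v (S i)) Q) = cross (E i) U).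
{ rewrite vert_S. fold (E i). unfold U, P, side_point. fold (E i).
  generalize (vert d v i) (E i) Q; intros; pt_simpl; ring. }
assert (WP : W md P - W (at_side i) P = - turn (- cross (E j) U)).
{ unfold W, turning. rewrite (sum_change _ _ j).
  - unfold md, at_side. rewrite Nat.eqb_refl.
    replace (Nat.eqb j i) with false by (symmetry; apply Nat.eqb_neq; lia). simpl.
    rewrite ang2_flip by (rewrite c1; lra). rewrite c1. ring.
  - lia.
  - intros k hk nk. unfold md, at_side. replace (Nat.eqb k j) with false by (symmetry; apply Nat.eqb_neq; lia).
    now rewrite Bool.orb_false_r. }
assert (WQ : W md Q - W (at_side j) Q = - turn (cross (E i) U)).
{ unfold W, turning. rewrite (sum_change _ _ i).
  - unfold md, at_side. rewrite Nat.eqb_refl.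
    replace (Nat.eqb i j) with false by (symmetry; apply Nat.eqb_neq; lia). simpl.
    rewrite ang2_flip by (rewrite c2; lra). rewrite c2. ring.
  - lia.
  - intros k hk nk. unfold md, at_side. replace (Nat.eqb k i) with false by (symmetry; apply Nat.eqb_neq; lia).
    reflexivity. }
assert (T := turning_common i j t t' hi hj ht ht'). fold P Q in T.
assert (tt : turn (- cross (E j) U) = turn (cross (E i) U)) by lra.
unfold turn in tt. pose proof PI_RGT_0.
destruct (Rlt_dec 0 (- cross (E j) U)), (Rlt_dec 0 (cross (E i) U)); lra.
Qed.

End Sides.

(** * Angles along an orbit *)

Definition rat_pi (x : R) : Prop := exists p q : Z, (0 < q)%Z /\ x = IZR p / IZR q * PI.

Lemma rat_pi_add x y : rat_pi x -> rat_pi y -> rat_pi (x + y).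
Proof.
intros [p [q [hq ->]]] [p' [q' [hq' ->]]]. exists (p * q' + p' * q)%Z, (q * q')%Z.
split; [lia|]. rewrite plus_IZR, !mult_IZR. apply IZR_lt in hq, hq'. field; lra.
Qed.

Lemma rat_pi_opp x : rat_pi x -> rat_pi (- x).
Proof.
intros [p [q [hq ->]]]. exists (- p)%Z, q. split; [lia|]. rewrite opp_IZR. apply IZR_lt in hq. field; lra.
Qed.

Lemma rat_pi_sub x y : rat_pi x -> rat_pi y -> rat_pi (x - y).
Proof. intros; apply rat_pi_add; [|apply rat_pi_opp]; assumption. Qed.

Lemma rat_pi_IZR k : rat_pi (IZR k * PI).
Proof. exists k, 1%Z. split; [lia|]. field. Qed.

Lemma rat_pi_0 : rat_pi 0.
Proof. replace 0 with (IZR 0 * PI) by ring. apply rat_pi_IZR. Qed.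

Lemma rat_pi_div_nat n x : rat_pi (INR (S n) * x) -> rat_pi x.
Proof.
intros [p [q [hq E]]]. exists p, (q * Z.of_nat (S n))%Z. split; [lia|].
rewrite mult_IZR, <- INR_IZR_INZ. apply IZR_lt in hq. assert (INR (S n) <> 0) by (apply not_0_INR; lia).
apply (Rmult_eq_reg_l (INR (S n))); [|assumption]. rewrite E. field; lra.
Qed.

Lemma unit_vector_angle a b : a * a + b * b = 1 -> exists t, a = cos t /\ b = sin t.
Proof.
intros H. assert (ha : -1 <= a <= 1) by (split; nra).
destruct (Rle_dec 0 b) as [hb|hb].
- exists (acos a). rewrite cos_acos, sin_acos by assumption. split; [reflexivity|].
  unfold Rsqr. replace (1 - a * a) with (b * b) by lra. now rewrite sqrt_square.
- exists (- acos a). rewrite cos_neg, sin_neg, cos_acos, sin_acos by assumption. split; [reflexivity|].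
  unfold Rsqr. replace (1 - a * a) with (- b * - b) by lra. rewrite sqrt_square; lra.
Qed.

Lemma vector_angle a : exists t, a = vscale (vnorm a) (cos t, sin t).
Proof.
destruct (Req_dec (vnorm a) 0) as [h|h].
- exists 0. rewrite h. rewrite (vnorm_eq0 a h) at 1. unfold vscale; simpl; f_equal; ring.
- destruct (unit_vector_angle (fst a / vnorm a) (snd a / vnorm a)) as [t [h1 h2]].
  + transitivity ((fst a * fst a + snd a * snd a) / (vnorm a * vnorm a)); [field; exact h|].
    rewrite vnorm_sqr. unfold dot. pose proof (vnorm_sqr a) as h'. unfold dot in h'.
    apply Rdiv_diag. rewrite <- h'. nra.
  + exists t. unfold vscale; simpl. rewrite <- h1, <- h2. destruct a; simpl; f_equal; field; exact h.
Qed.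

Section Dynamics.
Variables (d : nat) (v : nat -> pt).
Hypothesis Hsimple : simple_polygon d v.

Let E := edge_vec d v.

Definition edge_dir (i : nat) (phi : R) : Prop := E i = vscale (vnorm (E i)) (cos phi, sin phi).

(** At each vertex the edge direction turns by the exterior angle [PI - al]. The direction [phi0] of
    side 0 is arbitrary, so only differences of directions are rational. *)
Lemma rational_edge_dirs : rational_polygon d v ->
  exists phi0, forall i, (i < d)%nat -> exists r, rat_pi r /\ edge_dir i (phi0 + r).
Proof.
intros Hrat. destruct (vector_angle (E 0)) as [phi0 h0]. exists phi0.
induction i as [|i IH]; intros hi.
- exists 0. split; [apply rat_pi_0|]. now rewrite Rplus_0_r.
- destruct (IH ltac:(lia)) as [r [hr hE]].
  destruct (Hrat (S i) hi) as [al [p [q [[_ [hc hs]] [hq hal]]]]].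
  exists (r + (IZR 1 * PI - al)). split.
  { apply rat_pi_add, rat_pi_sub; [exact hr | apply rat_pi_IZR | now exists p, q]. }
  replace (vert d v (S i + d - 1)) with (vert d v i) in hc, hs.
  2: { unfold vert. replace (S i + d - 1)%nat with (i + 1 * d)%nat by lia. now rewrite Nat.Div0.mod_add. }
  fold (edge_vec d v (S i)) in hc, hs. fold (E (S i)) in hc, hs.
  assert (hb : vsub (vert d v i) (vert d v (S i)) = vneg (E i)).
  { rewrite vert_S. unfold E. generalize (vert d v i) (edge_vec d v i); intros; pt_simpl; f_equal; ring. }
  rewrite hb, vnorm_neg in hc, hs.
  assert (ni : 0 < vnorm (E i)) by (apply vnorm_pos, edge_nz; [exact Hsimple | lia]).
  unfold edge_dir in *. set (psi := phi0 + r) in *.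
  replace (phi0 + (r + (1 * PI - al))) with ((psi - al) + PI) by (unfold psi; ring).
  rewrite neg_cos, neg_sin, cos_minus, sin_minus.
  set (n := vnorm (E i)) in *. set (n' := vnorm (E (S i))) in *.
  rewrite hE in hc, hs. destruct (E (S i)) as [x y]. clearbody n n' psi.
  unfold vneg, vscale, dot, cross in *; simpl in *.
  pose proof (sin2_cos2 psi) as sc. unfold Rsqr in sc.
  assert (hc' : cos al * n' = - (x * cos psi + y * sin psi)) by (apply (Rmult_eq_reg_r n); lra).
  assert (hs' : sin al * n' = - (x * sin psi - y * cos psi)) by (apply (Rmult_eq_reg_r n); lra).
  f_equal.
  + transitivity (- (cos psi * (cos al * n') + sin psi * (sin al * n'))); [|ring].
    rewrite hc', hs'. transitivity (x * (sin psi * sin psi + cos psi * cos psi)); [rewrite sc|]; ring.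
  + transitivity (- (sin psi * (cos al * n') - cos psi * (sin al * n'))); [|ring].
    rewrite hc', hs'. transitivity (y * (sin psi * sin psi + cos psi * cos psi)); [rewrite sc|]; ring.
Qed.

Lemma out_dir_eq x : out_dir d v x = vscale (/ vnorm (E (side x)))
  (vadd (vscale (cos (ang x)) (- snd (E (side x)), fst (E (side x)))) (vscale (sin (ang x)) (E (side x)))).
Proof.
unfold out_dir, nrm, tang. fold (E (side x)). destruct (E (side x)) as [a b].
unfold vadd, vscale; simpl; f_equal; ring.
Qed.

Lemma in_phase_cos x : in_phase d x -> 0 < cos (ang x).
Proof. intros [_ [_ h]]. apply cos_gt_0; lra. Qed.

Lemma edge_norm_pos i : (i < d)%nat -> 0 < vnorm (E i).
Proof. intros h. apply vnorm_pos, edge_nz; assumption. Qed.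

Lemma out_dir_cross x : in_phase d x ->
  cross (E (side x)) (out_dir d v x) = vnorm (E (side x)) * cos (ang x).
Proof.
intros h. pose proof (edge_norm_pos (side x) (proj1 h)) as n. pose proof (vnorm_sqr (E (side x))) as n2.
rewrite out_dir_eq. set (N := vnorm (E (side x))) in *. destruct (E (side x)) as [a b].
unfold cross, vadd, vscale, dot in *; simpl in *.
transitivity (cos (ang x) * (a * a + b * b) / N); [field; lra|]. rewrite <- n2; field; lra.
Qed.

Lemma out_dir_dot x : in_phase d x ->
  dot (out_dir d v x) (E (side x)) = vnorm (E (side x)) * sin (ang x).
Proof.
intros h. pose proof (edge_norm_pos (side x) (proj1 h)) as n. pose proof (vnorm_sqr (E (side x))) as n2.
rewrite out_dir_eq. set (N := vnorm (E (side x))) in *. destruct (E (side x)) as [a b].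
unfold cross, vadd, vscale, dot in *; simpl in *.
transitivity (sin (ang x) * (a * a + b * b) / N); [field; lra|]. rewrite <- n2; field; lra.
Qed.

Lemma out_dir_unit x : in_phase d x -> dot (out_dir d v x) (out_dir d v x) = 1.
Proof.
intros h. pose proof (edge_norm_pos (side x) (proj1 h)) as n. pose proof (vnorm_sqr (E (side x))) as n2.
pose proof (sin2_cos2 (ang x)) as sc. unfold Rsqr in sc.
rewrite out_dir_eq. set (N := vnorm (E (side x))) in *. destruct (E (side x)) as [a b].
unfold cross, vadd, vscale, dot in *; simpl in *.
transitivity ((sin (ang x) * sin (ang x) + cos (ang x) * cos (ang x)) * (a * a + b * b) / (N * N)); [field; lra|].
rewrite sc, <- n2; field; lra.
Qed.

(** The angle that [Phi] itself would produce on side [j], before [R_lam] multiplies it by [lam]. *)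
Definition incidence (x : phase) (j : nat) : R :=
  atan (dot (out_dir d v x) (tang d v j) / - dot (out_dir d v x) (nrm d v j)).

Lemma step_sides lam x y : pinball_step d v lam x y -> side x <> side y.
Proof.
intros [hx [hy [tau [ht [hp _]]]]] eq.
assert (h : cross (E (side x)) (vsub (ph_point d v y) (ph_point d v x)) = tau * cross (E (side x)) (out_dir d v x)).
{ rewrite hp. generalize (E (side x)) (ph_point d v x) (out_dir d v x); intros; pt_simpl; ring. }
rewrite out_dir_cross in h by assumption.
assert (h0 : cross (E (side x)) (vsub (ph_point d v y) (ph_point d v x)) = 0).
{ unfold ph_point. rewrite <- eq. fold (E (side x)). generalize (E (side x)) (vert d v (side x)); intros; pt_simpl; ring. }
pose proof (in_phase_cos x hx). pose proof (edge_norm_pos (side x) (proj1 hx)).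
assert (0 < tau * (vnorm (E (side x)) * cos (ang x))) by (repeat apply Rmult_lt_0_compat; assumption). lra.
Qed.

Lemma step_cross_lt lam x y : pinball_step d v lam x y -> cross (E (side y)) (out_dir d v x) < 0.
Proof.
intros st. pose proof (step_sides _ _ _ st) as ne.
destruct st as [hx [hy [tau [ht [hp [clear _]]]]]].
set (u := out_dir d v x) in *. set (P := ph_point d v x) in *.
assert (ci : 0 < cross (E (side x)) u).
{ unfold u. rewrite out_dir_cross by assumption. apply Rmult_lt_0_compat; [apply edge_norm_pos, hx | apply in_phase_cos, hx]. }
assert (sj : 0 < dot (E (side y)) (E (side y))).
{ rewrite <- vnorm_sqr. pose proof (edge_norm_pos (side y) (proj1 hy)). nra. }
assert (cj : cross (E (side y)) u <> 0).
(* A flight parallel to side [y] that ends inside it would run along it shortly before time [tau].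
   The delay [eta] is small enough for the point at time [tau - eta] to lie still on that side. *)
{ intros c0. set (c := dot (E (side y)) u / dot (E (side y)) (E (side y))).
  assert (uc : u = vscale c (E (side y))).
  { unfold c. clearbody u. destruct u as [u1 u2], (E (side y)) as [a b]. unfold cross, dot, vscale in *; simpl in *.
    assert (c1 : a * (a * u2 - b * u1) = 0) by (rewrite c0; ring).
    assert (c2 : b * (a * u2 - b * u1) = 0) by (rewrite c0; ring).
    f_equal; apply (Rmult_eq_reg_r (a * a + b * b)); try lra.
    - transitivity ((a * u1 + b * u2) * a); [lra | field; lra].
    - transitivity ((a * u1 + b * u2) * b); [lra | field; lra]. }
  set (m := Rmin (pos y) (1 - pos y)).
  assert (hm : 0 < m /\ m <= pos y /\ m <= 1 - pos y).
  { destruct hy as [_ [[h1 h2] _]]. unfold m. split; [apply Rmin_pos; lra|]. split; [apply Rmin_l | apply Rmin_r]. }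
  set (eta := Rmin (tau / 2) (m / (Rabs c + 1))).
  pose proof (Rabs_pos c) as ac.
  assert (he : 0 < eta /\ eta <= tau / 2 /\ eta * (Rabs c + 1) <= m).
  { unfold eta. assert (0 < m / (Rabs c + 1)) by (apply Rdiv_lt_0_compat; lra).
    split; [apply Rmin_pos; lra|]. split; [apply Rmin_l|].
    apply Rle_trans with (m / (Rabs c + 1) * (Rabs c + 1)); [apply Rmult_le_compat_r; [lra | apply Rmin_r]|].
    right; field; lra. }
  apply (clear (tau - eta)); [lra|]. exists (side y). split; [apply hy|].
  exists (pos y - eta * c). split.
  - assert (Rabs (eta * c) <= m).
    { rewrite Rabs_mult, (Rabs_right eta) by lra. nra. }
    pose proof (Rle_abs (eta * c)). pose proof (Rle_abs (- (eta * c))) as h'. rewrite Rabs_Ropp in h'. lra.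
  - transitivity (vadd (ph_point d v y) (vscale (- eta) u)).
    + rewrite hp. generalize P u; intros; pt_simpl; f_equal; ring.
    + rewrite uc. unfold ph_point. fold (E (side y)). generalize (E (side y)) (vert d v (side y)) c; intros; pt_simpl; f_equal; ring. }
assert (U : vsub (ph_point d v y) P = vscale tau u).
{ rewrite hp. generalize P u; intros; pt_simpl; f_equal; ring. }
pose proof (chord_sides d v Hsimple (side x) (side y) (pos x) (pos y) (proj1 hx) (proj1 hy) ne
  (proj1 (proj2 hx)) (proj1 (proj2 hy))) as key.
cbv zeta in key.
change (side_point d v (side x) (pos x)) with P in key.
change (side_point d v (side y) (pos y)) with (ph_point d v y) in key.
rewrite U in key. fold (E (side x)) (E (side y)) in key.
assert (s : forall a, cross a (vscale tau u) = tau * cross a u) by (intros; generalize u; intros; pt_simpl; ring).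
rewrite !s in key.
assert (k : tau * cross (E (side y)) u < 0).
{ apply key.
  - intros r hr. replace (vscale r (vscale tau u)) with (vscale (r * tau) u) by (generalize u; intros; pt_simpl; f_equal; ring).
    apply clear. nra.
  - apply Rgt_not_eq. nra.
  - apply Rmult_integral_contrapositive_currified; [lra | exact cj].
  - nra. }
nra.
Qed.

(** Because the chord arrives from the inner side, the denominator under [atan] is positive; hence
    [atan] returns the true angle of incidence and not that angle modulo [PI]. *)
Lemma step_incidence lam x y : pinball_step d v lam x y ->
  let b := incidence x (side y) in
  - (PI / 2) < b < PI / 2 /\ ang y = lam * b /\
  dot (out_dir d v x) (E (side y)) = vnorm (E (side y)) * sin b /\
  cross (E (side y)) (out_dir d v x) = - (vnorm (E (side y)) * cos b).
Proof.
intros st. pose proof (step_cross_lt _ _ _ st) as cl. destruct st as [hx [hy [tau [_ [_ [_ ha]]]]]].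
cbv zeta. split; [unfold incidence; match goal with |- context [atan ?t] => destruct (atan_bound t) end; lra|]. split; [exact ha|].
pose proof (edge_norm_pos (side y) (proj1 hy)) as n. pose proof (out_dir_unit x hx) as un.
pose proof (vnorm_sqr (E (side y))) as n2.
set (u := out_dir d v x) in *. set (N := vnorm (E (side y))) in *.
assert (ds : dot u (tang d v (side y)) = dot u (E (side y)) / N).
{ unfold tang. fold (E (side y)). fold N. generalize u (E (side y)) N; intros; pt_simpl; unfold Rdiv; ring. }
assert (dn : dot u (nrm d v (side y)) = cross (E (side y)) u / N).
{ unfold nrm, tang. fold (E (side y)). fold N. generalize u (E (side y)) N; intros; pt_simpl; unfold Rdiv; ring. }
unfold incidence. fold u. rewrite ds, dn.
assert (sq : dot u (E (side y)) * dot u (E (side y)) + cross (E (side y)) u * cross (E (side y)) u = N * N).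
{ rewrite n2. replace (dot (E (side y)) (E (side y))) with (dot (E (side y)) (E (side y)) * dot u u) by (rewrite un; ring).
  generalize u (E (side y)); intros; pt_simpl; ring. }
set (A := dot u (E (side y))) in *. set (B := cross (E (side y)) u) in *.
replace (A / N / - (B / N)) with (A / - B) by (field; lra).
set (b := atan (A / - B)).
assert (cb : 0 < cos b) by (destruct (atan_bound (A / - B)); apply cos_gt_0; unfold b; lra).
assert (tb : sin b = A / - B * cos b).
{ rewrite <- (tan_atan (A / - B)); fold b; unfold tan; field; lra. }
assert (e : cos b * cos b * (N * N) = B * B).
{ rewrite <- sq. pose proof (sin2_cos2 b) as h; unfold Rsqr in h; rewrite tb in h.
  replace (B * B) with (B * B * 1) at 2 by ring. rewrite <- h; field; lra. }
assert (e2 : N * cos b = - B).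
{ assert (0 < N * cos b) by (apply Rmult_lt_0_compat; assumption).
  assert ((N * cos b - - B) * (N * cos b + - B) = 0) by (ring_simplify; nra).
  apply Rmult_integral in H0. destruct H0; lra. }
split; [|lra]. rewrite tb. transitivity (A / - B * (N * cos b)); [rewrite e2; field; lra | ring].
Qed.

Lemma cos_eq_1_small t : - (2 * PI) < t < 2 * PI -> cos t = 1 -> t = 0.
Proof.
intros h c. replace t with (2 * (t / 2)) in c by field. rewrite cos_2a_sin in c.
assert (s : sin (t / 2) = 0) by nra.
destruct (Rtotal_order (t / 2) 0) as [l|[l|l]]; [|lra|].
- pose proof (sin_lt_0_var (t / 2)); lra.
- pose proof (sin_gt_0 (t / 2)); lra.
Qed.

(** The flight has direction [phi + PI / 2 - ang x] read off its start and [phi' - PI / 2 + b] read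
    off its end, [b] being the incidence. Equating the two modulo [2 * PI] gives the claim. *)
Lemma step_angle_sum_cos lam x y phi phi' : pinball_step d v lam x y ->
  edge_dir (side x) phi -> edge_dir (side y) phi' ->
  cos (incidence x (side y) + ang x + phi' - phi) = -1.
Proof.
intros st e e'. destruct (step_incidence _ _ _ st) as [_ [_ [h1 h2]]].
destruct st as [hx [hy _]].
pose proof (edge_norm_pos (side y) (proj1 hy)) as n. pose proof (edge_norm_pos (side x) (proj1 hx)) as n'.
set (b := incidence x (side y)) in *. rewrite out_dir_eq in h1, h2. unfold edge_dir in *.
set (N := vnorm (E (side y))) in *. set (N' := vnorm (E (side x))) in *.
rewrite e, e' in h1, h2. clearbody N N' b. unfold dot, cross, vadd, vscale in *; simpl in *.
assert (k1 : sin (ang x + phi' - phi) = sin b).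
{ apply (Rmult_eq_reg_l N); [|lra]. rewrite <- h1.
  replace (ang x + phi' - phi) with (ang x + (phi' - phi)) by ring.
  rewrite sin_plus, cos_minus, sin_minus. field; lra. }
assert (k2 : cos (ang x + phi' - phi) = - cos b).
{ apply (Rmult_eq_reg_l N); [|lra]. rewrite Ropp_mult_distr_r_reverse, <- h2.
  replace (ang x + phi' - phi) with (ang x + (phi' - phi)) by ring.
  rewrite cos_plus, cos_minus, sin_minus. field; lra. }
replace (b + ang x + phi' - phi) with (b + (ang x + phi' - phi)) by ring.
rewrite cos_plus, k1, k2. pose proof (sin2_cos2 b) as sc; unfold Rsqr in sc. lra.
Qed.

(** The sum is known modulo [2 * PI] from the sides, and both summands lie within [PI / 2] of zero,
    so two such sums differ by less than [2 * PI]. *)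
Lemma step_angle_sum_unique lam lam' x y x' y' :
  pinball_step d v lam x y -> pinball_step d v lam' x' y' -> side x = side x' -> side y = side y' ->
  incidence x (side y) + ang x = incidence x' (side y') + ang x'.
Proof.
intros st st' e e'.
destruct (vector_angle (E (side x))) as [phi hphi]. destruct (vector_angle (E (side y))) as [phi' hphi'].
pose proof (step_angle_sum_cos _ _ _ phi phi' st hphi hphi') as c.
assert (c' : cos (incidence x' (side y') + ang x' + phi' - phi) = -1).
{ apply (step_angle_sum_cos _ _ _ _ _ st'); unfold edge_dir; [rewrite <- e | rewrite <- e']; assumption. }
destruct (step_incidence _ _ _ st) as [b1 _]. destruct (step_incidence _ _ _ st') as [b2 _].
destruct st as [[_ [_ a1]] _]. destruct st' as [[_ [_ a2]] _].
set (b := incidence x (side y)) in *. set (b' := incidence x' (side y')) in *.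
apply Rminus_diag_uniq. apply cos_eq_1_small; [lra|].
replace (b + ang x - (b' + ang x')) with ((b + ang x + phi' - phi) - (b' + ang x' + phi' - phi)) by ring.
set (A := b + ang x + phi' - phi) in *. set (A' := b' + ang x' + phi' - phi) in *.
assert (s : sin A = 0). { pose proof (sin2_cos2 A) as sc; unfold Rsqr in sc. rewrite c in sc. nra. }
rewrite cos_minus, c, c', s. ring.
Qed.

Lemma step_angle_sum_rat lam x y : rational_polygon d v -> pinball_step d v lam x y ->
  rat_pi (incidence x (side y) + ang x).
Proof.
intros Hrat st. destruct (rational_edge_dirs Hrat) as [phi0 H].
assert (hx : in_phase d x) by apply st. assert (hy : in_phase d y) by apply st.
destruct (H (side x) (proj1 hx)) as [r [hr e]]. destruct (H (side y) (proj1 hy)) as [r' [hr' e']].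
pose proof (step_angle_sum_cos _ _ _ _ _ st e e') as c.
set (A := incidence x (side y) + ang x + (phi0 + r') - (phi0 + r)) in *.
assert (s : sin A = 0). { pose proof (sin2_cos2 A) as sc; unfold Rsqr in sc. rewrite c in sc. nra. }
destruct (sin_eq_0_0 _ s) as [k hk].
replace (incidence x (side y) + ang x) with (IZR k * PI - (r' - r)) by (unfold A in hk; lra).
apply rat_pi_sub; [apply rat_pi_IZR | now apply rat_pi_sub].
Qed.

End Dynamics.

(** * Rationality of the angles of stable orbits *)

Lemma Un_cv_sum (f : nat -> nat -> R) (l : nat -> R) n :
  (forall k, Un_cv (fun m => f m k) (l k)) ->
  Un_cv (fun m => sum_f_R0 (f m) n) (sum_f_R0 l n).
Proof.
intros H. induction n as [|n IH]; simpl; [apply H|].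
apply (CV_plus (fun m => sum_f_R0 (f m) n) (fun m => f m (S n))); auto.
Qed.

Lemma Un_cv_const_inv c (u : nat -> R) l : (forall m, u m = c) -> Un_cv u l -> l = c.
Proof.
intros hu hl. apply (UL_sequence u); [exact hl|].
intros eps he. exists 0%nat. intros m _. rewrite hu. unfold Rdist. rewrite Rminus_diag, Rabs_R0. exact he.
Qed.

Lemma reflect_coords (e u : pt) : 0 < dot e e ->
  let r := vsub (vscale (2 * dot u e / dot e e) e) u in
  let c := (fst e * fst e - snd e * snd e) * / (fst e * fst e + snd e * snd e) in
  let s := 2 * fst e * snd e * / (fst e * fst e + snd e * snd e) in
  fst r = c * fst u + s * snd u /\ snd r = s * fst u - c * snd u.
Proof.
destruct e as [e1 e2], u as [u1 u2]. unfold dot, vsub, vscale; simpl. intros h.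
split; field; lra.
Qed.

Lemma pow_m1_sqr k : (-1) ^ k * (-1) ^ k = 1.
Proof. rewrite <- Rpow_mult_distr. replace (-1 * -1) with 1 by ring. apply pow1. Qed.

Section Dynamics.
Variables (d : nat) (v : nat -> pt).
Hypothesis Hsimple : simple_polygon d v.

Lemma periodic_mult (A : Type) (x : nat -> A) n j k :
  (forall k, x (k + n)%nat = x k) -> x (k + j * n)%nat = x k.
Proof.
intros H. induction j as [|j IH]; simpl; [f_equal; lia|].
rewrite <- IH, <- (H (k + j * n)%nat). f_equal; lia.
Qed.

Lemma orbit_recurrence lam lam' (q x : nat -> phase) :
  is_periodic_orbit d v lam q -> is_periodic_orbit d v lam' x -> same_itinerary x q ->
  forall k, ang (x (S k)) = lam' * (incidence d v (q k) (side (q (S k))) + ang (q k) - ang (x k)).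
Proof.
intros [hq _] [hx _] hs k.
destruct (step_incidence d v Hsimple _ _ _ (hx k)) as [_ [e _]]. rewrite e.
pose proof (step_angle_sum_unique d v Hsimple _ _ _ _ _ _ (hx k) (hq k) (hs k) (hs (S k))). f_equal. lra.
Qed.

(** The recurrence multiplied by [(-1) ^ k] telescopes up to the factor [1 - lam]. Over an even
    number of steps on which [th] returns, the boundary terms cancel, and for [lam = 1] so does the
    sum of the angles. *)
Lemma alternating_sum (th c : nat -> R) lam n :
  (forall k, th (S k) = lam * (c k - th k)) ->
  (-1) ^ S n * th (S n) - th 0%nat + (1 - lam) * sum_f_R0 (fun k => (-1) ^ k * th k) n
  = - lam * sum_f_R0 (fun k => (-1) ^ k * c k) n.
Proof.
intros H. induction n as [|n IH].
- simpl. rewrite H. ring.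
- rewrite (tech5 _ n), (tech5 (fun k => (-1) ^ k * c k) n), !Rmult_plus_distr_l, <- IH, (H (S n)).
  simpl. ring.
Qed.

Lemma stable_angles_rational (q : nat -> phase) : rational_polygon d v ->
  lam_plus_stable d v q -> forall k, rat_pi (ang (q k)).
Proof.
intros Hrat [hq [lams [qs [lpos [ldec [lcv [hqs cv]]]]]]].
assert (lgt : forall m, 1 < lams m).
{ intros m. apply Rle_lt_trans with (lams (S m)); [|apply ldec].
  apply (decreasing_ineq lams 1); [|exact lcv]. intros j. left. apply ldec. }
pose proof hq as [hstep [n [hn hper]]].
set (c := fun k => incidence d v (q k) (side (q (S k))) + ang (q k)).
assert (cper : forall k, c (k + 2 * n)%nat = c k).
{ intros k. unfold c. rewrite periodic_mult by exact hper.
  replace (S (k + 2 * n)) with (S k + 2 * n)%nat by lia. now rewrite periodic_mult by exact hper. }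
assert (crat : forall k, rat_pi (c k)).
{ intros k. apply (step_angle_sum_rat d v Hsimple 1); auto. }
assert (rec1 : forall k, ang (q (S k)) = 1 * (c k - ang (q k))).
{ intros k. apply (orbit_recurrence 1 1 q q); auto. intros j; reflexivity. }
set (N := pred (2 * n)).
assert (SN : S N = (2 * n)%nat) by (unfold N; lia).
assert (evN : (-1) ^ S N = 1) by (rewrite SN; apply pow_1_even).
assert (C0 : sum_f_R0 (fun k => (-1) ^ k * c k) N = 0).
{ pose proof (alternating_sum (fun k => ang (q k)) c 1 N rec1) as h.
  cbv beta in h. rewrite evN, SN in h. change (2 * n)%nat with (0 + 2 * n)%nat in h.
  rewrite periodic_mult in h by exact hper. lra. }
assert (Sm : forall m, sum_f_R0 (fun k => (-1) ^ k * ang (qs m k)) N = 0).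
{ intros m. destruct (hqs m) as [hm him]. set (lam := lams m) in *. pose proof (lgt m) as l1. fold lam in l1.
  assert (rec : forall k, ang (qs m (S k)) = lam * (c k - ang (qs m k))).
  { intros k. apply (orbit_recurrence 1 lam q (qs m)); auto. }
  destruct hm as [hst [M [hM hpM]]].
  (* The nearby orbit is only known to have some period [M] of its own. Its angles shifted by
     [2 * n] satisfy the same recurrence, so the difference [del] is multiplied by [- lam] at every
     step; being [M]-periodic with [lam > 1], it vanishes. *)
  set (del := fun k => ang (qs m (k + 2 * n)%nat) - ang (qs m k)).
  assert (dk : forall k, del k = (- lam) ^ k * del 0%nat).
  { induction k as [|k IH]; [simpl; ring|].
    transitivity (- lam * del k); [|rewrite IH; simpl; ring].
    unfold del. replace (S k + 2 * n)%nat with (S (k + 2 * n)) by lia. rewrite !rec, cper. ring. }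
  assert (d0 : del 0%nat = 0).
  { assert (dM : del M = del 0%nat).
    { unfold del. replace (M + 2 * n)%nat with ((0 + 2 * n) + M)%nat by lia. rewrite hpM.
      change M with (0 + M)%nat. now rewrite hpM. }
    rewrite dk in dM.
    assert (Rabs ((- lam) ^ M) > 1).
    { rewrite <- RPow_abs, Rabs_Ropp, Rabs_right by lra. apply Rlt_pow_R1; [lra | lia]. }
    assert (hz : ((- lam) ^ M - 1) * del 0%nat = 0) by lra.
    apply Rmult_integral in hz. destruct hz as [hz|hz]; [|exact hz].
    replace ((- lam) ^ M) with 1 in H by lra. rewrite Rabs_R1 in H. lra. }
  pose proof (alternating_sum (fun k => ang (qs m k)) c lam N rec) as h.
  cbv beta in h. rewrite evN, SN, C0 in h. unfold del in d0. change (0 + 2 * n)%nat with (2 * n)%nat in d0.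
  assert (hz : (1 - lam) * sum_f_R0 (fun k => (-1) ^ k * ang (qs m k)) N = 0) by lra.
  apply Rmult_integral in hz. destruct hz as [hz|hz]; [lra | exact hz]. }
assert (Sq : sum_f_R0 (fun k => (-1) ^ k * ang (q k)) N = 0).
{ apply (Un_cv_const_inv 0 _ _ Sm).
  apply (Un_cv_sum (fun m k => (-1) ^ k * ang (qs m k)) (fun k => (-1) ^ k * ang (q k))).
  intros k. apply (CV_mult (fun _ => (-1) ^ k)); [|apply cv].
  intros eps he. exists 0%nat. intros. unfold Rdist. rewrite Rminus_diag, Rabs_R0. exact he. }
assert (sgn : forall k x, rat_pi x -> rat_pi ((-1) ^ k * x)).
{ intros k x hx. induction k as [|k IH]; simpl; [now rewrite Rmult_1_l|].
  replace (-1 * (-1) ^ k * x) with (- ((-1) ^ k * x)) by ring. now apply rat_pi_opp. }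
(* At [lam = 1] the signed angle [(-1) ^ k * ang (q k)] changes at each step by a rational multiple
   of [PI], so the vanishing alternating sum is [INR (S N) * ang (q 0%nat)] up to such a
   multiple. *)
assert (dif : forall k, rat_pi ((-1) ^ k * ang (q k) - ang (q 0%nat))).
{ induction k as [|k IH]; [simpl; replace (1 * _ - _) with 0 by ring; apply rat_pi_0|].
  rewrite rec1. replace (_ - _) with (((-1) ^ k * ang (q k) - ang (q 0%nat)) - (-1) ^ k * c k) by (simpl; ring).
  apply rat_pi_sub; [exact IH | now apply sgn]. }
assert (tot : forall j, rat_pi (sum_f_R0 (fun k => (-1) ^ k * ang (q k)) j - INR (S j) * ang (q 0%nat))).
{ induction j as [|j IH].
  - simpl. replace (_ - _) with 0 by ring. apply rat_pi_0.
  - rewrite tech5, S_INR.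
    replace (_ - _) with ((sum_f_R0 (fun k => (-1) ^ k * ang (q k)) j - INR (S j) * ang (q 0%nat))
      + ((-1) ^ S j * ang (q (S j)) - ang (q 0%nat))) by ring.
    apply rat_pi_add; [exact IH | apply dif]. }
assert (r0 : rat_pi (ang (q 0%nat))).
{ apply (rat_pi_div_nat N). pose proof (tot N) as h. rewrite Sq in h. apply rat_pi_opp in h.
  replace (INR (S N) * ang (q 0%nat)) with (- (0 - INR (S N) * ang (q 0%nat))) by ring. exact h. }
intros k.
replace (ang (q k)) with ((-1) ^ k * (((-1) ^ k * ang (q k) - ang (q 0%nat)) + ang (q 0%nat))).
- apply sgn, rat_pi_add; [apply dif | exact r0].
- transitivity ((-1) ^ k * (-1) ^ k * ang (q k)); [ring|]. rewrite pow_m1_sqr; ring.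
Qed.

Lemma periodic_shift lam (q : nat -> phase) k :
  is_periodic_orbit d v lam q -> is_periodic_orbit d v lam (fun j => q (j + k)%nat).
Proof.
intros [h [n [hn hp]]]. split.
- intros j. apply (h (j + k)%nat).
- exists n. split; [exact hn|]. intros j. rewrite <- (hp (j + k)%nat). f_equal; lia.
Qed.

Lemma step_reflect x y : pinball_step d v 1 x y ->
  let e := edge_vec d v (side y) in let u := out_dir d v x in
  out_dir d v y = vsub (vscale (2 * dot u e / dot e e) e) u.
Proof.
intros st. cbv zeta. destruct (step_incidence d v Hsimple _ _ _ st) as [_ [ha [h1 h2]]].
destruct st as [hx [hy _]]. pose proof (edge_norm_pos d v Hsimple _ (proj1 hy)) as n.
pose proof (vnorm_sqr (edge_vec d v (side y))) as n2.
rewrite (out_dir_eq d v y), ha, Rmult_1_l. set (b := incidence d v x (side y)) in *.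
set (N := vnorm (edge_vec d v (side y))) in *. set (e := edge_vec d v (side y)) in *.
set (u := out_dir d v x) in *. clearbody N b e u.
assert (hs : sin b = dot u e / N) by (rewrite h1; field; lra).
assert (hc : cos b = - cross e u / N) by (rewrite h2; field; lra).
rewrite hs, hc, <- n2. destruct e as [a c], u as [u1 u2].
unfold vadd, vsub, vscale, dot, cross in *; simpl in *.
assert (ne : N <> 0) by lra.
f_equal; apply (Rmult_eq_reg_r (N * N)); try nra.
- transitivity (2 * (u1 * a + u2 * c) * a - u1 * (a * a + c * c)); [|rewrite <- n2]; field; exact ne.
- transitivity (2 * (u1 * a + u2 * c) * c - u2 * (a * a + c * c)); [|rewrite <- n2]; field; exact ne.
Qed.

(** * Unfolding over the coordinate field *)

Variable K : R -> Prop.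
Hypothesis K1 : K 1.
Hypothesis Kadd : forall x y, K x -> K y -> K (x + y).
Hypothesis Kmul : forall x y, K x -> K y -> K (x * y).
Hypothesis Kopp : forall x, K x -> K (- x).
Hypothesis Kinv : forall x, K x -> K (/ x).
Hypothesis Kv : forall i, (i < d)%nat -> K (fst (v i)) /\ K (snd (v i)).

Lemma K_sub x y : K x -> K y -> K (x - y).
Proof. intros; apply Kadd; auto. Qed.

Lemma K_vert i : K (fst (vert d v i)) /\ K (snd (vert d v i)).
Proof. apply Kv. apply Nat.mod_upper_bound. destruct Hsimple; lia. Qed.

Lemma K_edge i : K (fst (edge_vec d v i)) /\ K (snd (edge_vec d v i)).
Proof.
unfold edge_vec, vsub; simpl. destruct (K_vert i), (K_vert (S i)). split; apply K_sub; auto.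
Qed.

(* [w |-> (a w1 - e b w2 + c1, b w1 + e a w2 + c2)] is the unfolding of the k-th reflected copy
   of the polygon; in it the orbit is a straight line. *)
Lemma unfolding (q : nat -> phase) : (forall k, pinball_step d v 1 (q k) (q (S k))) ->
  let u k := out_dir d v (q k) in let p k := ph_point d v (q k) in
  forall k, exists a b c1 c2 sg, K a /\ K b /\ K c1 /\ K c2 /\ 0 <= sg /\ ((0 < k)%nat -> 0 < sg) /\
  let e := (-1) ^ k in
  a * fst (u k) - e * b * snd (u k) = fst (u 0%nat) /\ b * fst (u k) + e * a * snd (u k) = snd (u 0%nat) /\
  a * fst (p k) - e * b * snd (p k) + c1 = fst (p 0%nat) + sg * fst (u 0%nat) /\
  b * fst (p k) + e * a * snd (p k) + c2 = snd (p 0%nat) + sg * snd (u 0%nat).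
Proof.
intros st u p. assert (K0 : K 0) by (replace 0 with (1 + - (1)) by ring; auto).
induction k as [|k [a [b [c1 [c2 [sg [ha [hb [hc1 [hc2 [h0 [_ [u1 [u2 [p1 p2]]]]]]]]]]]]]]].
- exists 1, 0, 0, 0, 0. repeat split; auto; try lra; try lia; simpl; ring.
- pose proof (step_reflect _ _ (st k)) as hr. cbv zeta in hr. fold (u k) (u (S k)) in hr.
  destruct (st k) as [_ [hy [tau [ht [hp _]]]]]. fold (p k) (p (S k)) (u k) in hp.
  set (j := side (q (S k))) in *. set (t := pos (q (S k))) in *.
  assert (pj : p (S k) = vadd (vert d v j) (vscale t (edge_vec d v j))) by reflexivity.
  destruct (K_edge j) as [s1 s2]. destruct (K_vert j) as [w1 w2].
  assert (ne : 0 < dot (edge_vec d v j) (edge_vec d v j)).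
  { rewrite <- vnorm_sqr. pose proof (edge_norm_pos d v Hsimple _ (proj1 hy)) as n. fold j in n. nra. }
  assert (Ke : K ((-1) ^ k)).
  { assert (Km1 : K (-1)) by (replace (-1) with (- (1)) by ring; auto).
    clear -K1 Kmul Km1. induction k; simpl; auto. }
  set (e := (-1) ^ k) in *. assert (e2 : e * e = 1) by apply pow_m1_sqr.
  assert (eS : (-1) ^ (S k) = - e) by (unfold e; simpl; ring). rewrite eS.
  set (E := edge_vec d v j) in *. set (V := vert d v j) in *.
  (* [C] and [D] are the cosine and sine of twice the direction of side [j], that is, the matrix
     entries of the reflection in it; [f1] and [f2] below are its translation part. The next
     unfolding map is the current one composed with this reflection. *)
  set (C := (fst E * fst E - snd E * snd E) * / (fst E * fst E + snd E * snd E)).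
  set (D := 2 * fst E * snd E * / (fst E * fst E + snd E * snd E)).
  assert (KC : K C) by (apply Kmul; [apply K_sub|apply Kinv, Kadd]; auto).
  assert (KD : K D).
  { apply Kmul; [|apply Kinv, Kadd; auto]. replace (2 * fst E * snd E) with (fst E * snd E + fst E * snd E) by ring. auto. }
  assert (E1 : C * fst E + D * snd E = fst E) by (unfold C, D; unfold dot in ne; field; lra).
  assert (E2 : D * fst E - C * snd E = snd E) by (unfold C, D; unfold dot in ne; field; lra).
  assert (CD : C * C + D * D = 1) by (unfold C, D; unfold dot in ne; field; lra).
  assert (r1 : fst (u (S k)) = C * fst (u k) + D * snd (u k)).
  { rewrite hr. exact (proj1 (reflect_coords E (u k) ne)). }
  assert (r2 : snd (u (S k)) = D * fst (u k) - C * snd (u k)).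
  { rewrite hr. exact (proj2 (reflect_coords E (u k) ne)). }
  set (f1 := fst V - (C * fst V + D * snd V)). set (f2 := snd V - (D * fst V - C * snd V)).
  assert (Kf1 : K f1) by (apply K_sub; [|apply Kadd]; auto).
  assert (Kf2 : K f2) by (apply K_sub; [|apply K_sub]; auto).
  clearbody C D. clear hr.
  exists (a * C - e * b * D), (b * C + e * a * D), (a * f1 - e * b * f2 + c1), (b * f1 + e * a * f2 + c2), (sg + tau).
  split; [apply K_sub; repeat apply Kmul; auto|].
  split; [apply Kadd; repeat apply Kmul; auto|].
  split; [apply Kadd; [apply K_sub; repeat apply Kmul; auto|auto]|].
  split; [apply Kadd; [apply Kadd; repeat apply Kmul; auto|auto]|].
  split; [lra|]. split; [intros; lra|]. cbv zeta.
  rewrite r1, r2.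
  assert (P1 : C * fst (p (S k)) + D * snd (p (S k)) + f1 = fst (p (S k))).
  { unfold f1. rewrite pj. revert E1. generalize C D t V E. intros c s0 t0 [x y] [z w]; unfold vadd, vscale; simpl.
    intros h. transitivity (x + t0 * (c * z + s0 * w)); [ring | now rewrite h]. }
  assert (P2 : D * fst (p (S k)) - C * snd (p (S k)) + f2 = snd (p (S k))).
  { unfold f2. rewrite pj. revert E2. generalize C D t V E. intros c s0 t0 [x y] [z w]; unfold vadd, vscale; simpl.
    intros h. transitivity (y + t0 * (s0 * z - c * w)); [ring | now rewrite h]. }
  assert (q1 : fst (p (S k)) = fst (p k) + tau * fst (u k)) by (rewrite hp; reflexivity).
  assert (q2 : snd (p (S k)) = snd (p k) + tau * snd (u k)) by (rewrite hp; reflexivity).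
  clearbody f1 f2 u p. clear pj hp.
  set (x := fst (p (S k))) in *. set (y := snd (p (S k))) in *.
  clearbody x y. set (ux := fst (u k)) in *. set (uy := snd (u k)) in *. clearbody ux uy e.
  split; [|split; [|split]].
  + rewrite <- u1. transitivity ((a * ux) * (C * C + D * D) - e * b * uy * (C * C + D * D)
      + ((e * e - 1) * a * D * (D * ux - C * uy))); [ring|]. rewrite CD, e2. ring.
  + rewrite <- u2. transitivity ((b * ux) * (C * C + D * D) + e * a * uy * (C * C + D * D)
      + (1 - e * e) * 0 + (e * e - 1) * (b * D * (D * ux - C * uy))); [ring|]. rewrite CD, e2. ring.
  + transitivity (a * (C * x + D * y + f1) - e * b * (D * x - C * y + f2) + c1
      + (e * e - 1) * (a * D * y)); [ring|].
    rewrite P1, P2, e2, q1, q2.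
    transitivity ((a * fst (p k) - e * b * snd (p k) + c1) + tau * (a * ux - e * b * uy)); [ring|].
    rewrite p1, u1; ring.
  + transitivity (b * (C * x + D * y + f1) + e * a * (D * x - C * y + f2) + c2
      + (e * e - 1) * (b * D * y)); [ring|].
    rewrite P1, P2, e2, q1, q2.
    transitivity ((b * fst (p k) + e * a * snd (p k) + c2) + tau * (b * ux + e * a * uy)); [ring|].
    rewrite p2, u2; ring.
Qed.

Lemma periodic_tan_in_field (q : nat -> phase) : is_periodic_orbit d v 1 q ->
  forall k, K (sin (ang (q k)) / cos (ang (q k))).
Proof.
assert (base : forall q, is_periodic_orbit d v 1 q -> K (sin (ang (q 0%nat)) / cos (ang (q 0%nat)))).
{ clear q. intros q [st [n [hn hp]]].
  destruct (unfolding q st (2 * n)%nat) as [a [b [c1 [c2 [sg [ha [hb [h1 [h2 [_ [hs [u1 [u2 [p1 p2]]]]]]]]]]]]]].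
  specialize (hs ltac:(lia)). rewrite pow_1_even in u1, u2, p1, p2.
  assert (per : q (2 * n)%nat = q 0%nat) by (change (2 * n)%nat with (0 + 2 * n)%nat; now apply periodic_mult).
  rewrite per in u1, u2, p1, p2.
  assert (ph : in_phase d (q 0%nat)) by apply st.
  pose proof (out_dir_unit d v Hsimple _ ph) as un.
  pose proof (out_dir_cross d v Hsimple _ ph) as cr. pose proof (out_dir_dot d v Hsimple _ ph) as dt.
  pose proof (edge_norm_pos d v Hsimple _ (proj1 ph)) as n0. pose proof (in_phase_cos d _ ph) as c0.
  destruct (K_edge (side (q 0%nat))) as [s1 s2].
  set (e := edge_vec d v (side (q 0%nat))) in *. set (N := vnorm e) in *.
  set (u := out_dir d v (q 0%nat)) in *. set (p := ph_point d v (q 0%nat)) in *.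
  clearbody u p N. destruct e as [e1 e2], u as [x y], p as [px py].
  unfold dot, cross in *; simpl in *.
  (* After an even number of reflections the linear part has rows [(a, - b)] and [(b, a)]. Such a
     map fixing a nonzero vector is the identity, so [(c1, c2)], with entries in [K], equals [sg]
     times the direction of flight. *)
  assert (a1 : a = 1).
  { assert ((a - 1) * (x * x + y * y) = 0).
    { transitivity (x * (a * x - 1 * b * y - x) + y * (b * x + 1 * a * y - y)); [ring|]. rewrite u1, u2. ring. }
    rewrite un in H. lra. }
  assert (b0 : b = 0).
  { transitivity (b * (x * x + y * y)); [rewrite un; ring|].
    transitivity (x * (b * x + 1 * a * y - y) - y * (a * x - 1 * b * y - x)); [rewrite a1; ring|]. rewrite u1, u2; ring. }
  subst a b.
  assert (cx : c1 = sg * x) by lra. assert (cy : c2 = sg * y) by lra.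
  replace (sin (ang (q 0%nat)) / cos (ang (q 0%nat))) with ((c1 * e1 + c2 * e2) * / (e1 * c2 - e2 * c1)).
  - apply Kmul; [apply Kadd | apply Kinv, K_sub]; apply Kmul; auto.
  - transitivity ((sg * (x * e1 + y * e2)) * / (sg * (e1 * y - e2 * x))).
    + rewrite cx, cy. f_equal; [ring | f_equal; ring].
    + rewrite dt, cr. field. repeat split; lra. }
intros hq k. apply (base (fun j => q (j + k)%nat)). now apply periodic_shift.
Qed.

End Dynamics.

(** * Periodic cylinders *)

Lemma vector_eq0 (u w : pt) : dot u u = 1 -> cross u w = 0 -> dot w u = 0 -> w = (0, 0).
Proof.
destruct u as [a b], w as [x y]; unfold dot, cross; simpl. intros h1 h2 h3. f_equal.
- transitivity (x * (a * a + b * b)); [rewrite h1; ring|].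
  transitivity (a * (x * a + y * b) - b * (a * y - b * x)); [ring | rewrite h2, h3; ring].
- transitivity (y * (a * a + b * b)); [rewrite h1; ring|].
  transitivity (b * (x * a + y * b) + a * (a * y - b * x)); [ring | rewrite h2, h3; ring].
Qed.

Lemma parallel_eq (u w : pt) : dot u u = 1 -> cross u w = 0 -> w = vscale (dot w u) u.
Proof.
destruct u as [a b], w as [x y]; unfold dot, cross, vscale; simpl. intros h1 h2. f_equal.
- transitivity (x * (a * a + b * b)); [rewrite h1; ring|].
  transitivity ((x * a + y * b) * a - b * (a * y - b * x)); [ring | rewrite h2; ring].
- transitivity (y * (a * a + b * b)); [rewrite h1; ring|].
  transitivity ((x * a + y * b) * b + a * (a * y - b * x)); [ring | rewrite h2; ring].
Qed.

Section Strip.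
Variables (d : nat) (v : nat -> pt).
Hypothesis Hsimple : simple_polygon d v.

Let E := edge_vec d v.
Let sp := side_point d v.

(** Interpolating affinely between the two aligned pairs keeps them aligned with [u]. A change of
    order would make the offset along [u] vanish somewhere, giving a common point of the two sides
    in the interior of side [l]. *)
Lemma sides_keep_order k l a0 a1 b0 b1 u : (k < d)%nat -> (l < d)%nat -> k <> l ->
  0 <= a0 <= 1 -> 0 <= a1 <= 1 -> 0 < b0 < 1 -> 0 < b1 < 1 -> dot u u = 1 ->
  cross u (vsub (sp k a0) (sp l b0)) = 0 -> cross u (vsub (sp k a1) (sp l b1)) = 0 ->
  0 < dot (vsub (sp k a0) (sp l b0)) u * dot (vsub (sp k a1) (sp l b1)) u.
Proof.
intros hk hl ne ha0 ha1 hb0 hb1 un c0 c1.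
set (g0 := dot (vsub (sp k a0) (sp l b0)) u) in *. set (g1 := dot (vsub (sp k a1) (sp l b1)) u) in *.
destruct (Rlt_dec 0 (g0 * g1)) as [h|h]; [exact h|]. exfalso.
assert (ex : exists s, 0 <= s <= 1 /\ (1 - s) * g0 + s * g1 = 0).
{ destruct (Req_dec g0 0) as [e|e].
  - exists 0. split; lra.
  - exists (g0 / (g0 - g1)). destruct (Rlt_dec 0 g0).
    + assert (g1 <= 0) by nra. split; [|field; lra]. split.
      * apply Rmult_le_pos; [lra | left; apply Rinv_0_lt_compat; lra].
      * apply (Rmult_le_reg_r (g0 - g1)); [lra|]. unfold Rdiv. rewrite Rmult_assoc, Rinv_l by lra. lra.
    + assert (0 <= g1) by nra. split; [|field; lra].
      replace (g0 / (g0 - g1)) with (- g0 / (g1 - g0)) by (field; lra). split.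
      * apply Rmult_le_pos; [lra | left; apply Rinv_0_lt_compat; lra].
      * apply (Rmult_le_reg_r (g1 - g0)); [lra|]. unfold Rdiv. rewrite Rmult_assoc, Rinv_l by lra. lra. }
destruct ex as [s [hs e]].
assert (z : vsub (sp k (a0 + s * (a1 - a0))) (sp l (b0 + s * (b1 - b0))) = (0, 0)).
{ apply (vector_eq0 u); [exact un | |].
  - transitivity ((1 - s) * cross u (vsub (sp k a0) (sp l b0)) + s * cross u (vsub (sp k a1) (sp l b1))).
    + unfold sp, side_point. generalize (vert d v k) (edge_vec d v k) (vert d v l) (edge_vec d v l); intros; pt_simpl; ring.
    + rewrite c0, c1; ring.
  - rewrite <- e. unfold g0, g1, sp, side_point.
    generalize (vert d v k) (edge_vec d v k) (vert d v l) (edge_vec d v l); intros; pt_simpl; ring. }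
apply (open_side_disjoint d v Hsimple l k (b0 + s * (b1 - b0)) hl hk ltac:(auto)).
- now apply convex_open.
- exists (a0 + s * (a1 - a0)). split.
  + assert (0 <= (1 - s) * a0 + s * a1) by (apply Rplus_le_le_0_compat; apply Rmult_le_pos; lra).
    assert (0 <= (1 - s) * (1 - a0) + s * (1 - a1)) by (apply Rplus_le_le_0_compat; apply Rmult_le_pos; lra).
    lra.
  + change (sp l (b0 + s * (b1 - b0)) = sp k (a0 + s * (a1 - a0))).
    revert z. generalize (sp k (a0 + s * (a1 - a0))) (sp l (b0 + s * (b1 - b0))).
    intros [x y] [x' y'] z. unfold vsub in z; simpl in z. injection z; intros; f_equal; lra.
Qed.

(* Over a strip that contains no vertex the sides are disjoint graphs, so their order along the
   direction [u] is constant and the first side met from side [i] does not change. *)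
Lemma strip_extension i j t r u tau sg L del di dj :
  (i < d)%nat -> (j < d)%nat -> i <> j -> 0 < t < 1 -> 0 < r < 1 -> dot u u = 1 ->
  sg * sg = 1 -> 0 < tau -> sp j r = vadd (sp i t) (vscale tau u) ->
  (forall s, 0 < s < tau -> ~ on_boundary d v (vadd (sp i t) (vscale s u))) ->
  (forall w, (w < d)%nat -> ~ 0 < sg * cross u (vsub (vert d v w) (sp i t)) < L) ->
  0 < del < L -> sg * cross u (E i) * di = del -> sg * cross u (E j) * dj = del ->
  0 < t + di < 1 /\ 0 < r + dj < 1 /\
  exists tau', 0 < tau' /\ sp j (r + dj) = vadd (sp i (t + di)) (vscale tau' u) /\
    (forall s, 0 < s < tau' -> ~ on_boundary d v (vadd (sp i (t + di)) (vscale s u))).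
Proof.
intros hi hj ne ht hr un sg2 htau hQ clear nov hdel hdi hdj.
(* [h] is the signed height over the line of the flight, affine along every side; no vertex has
   height strictly between 0 and [L]. *)
set (h := fun w => sg * cross u (vsub w (sp i t))).
assert (hsp : forall k s, h (sp k s) = h (vert d v k) + s * (sg * cross u (E k))).
{ intros. unfold h, sp, side_point, E. generalize (vert d v k) (edge_vec d v k) (vert d v i) (edge_vec d v i); intros; pt_simpl; ring. }
assert (hS : forall k, h (vert d v (S k)) = h (vert d v k) + sg * cross u (E k)).
{ intros k. rewrite vert_side1. fold sp. rewrite hsp. ring. }
assert (nov' : forall k, (k <= d)%nat -> ~ 0 < h (vert d v k) < L).
{ intros k hk. destruct (Nat.eq_dec k d) as [->|n].
  - rewrite (vert_d d v Hsimple). apply nov. lia.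
  - apply nov. lia. }
assert (hP : h (sp i t) = 0) by (unfold h; generalize (sp i t); intros; pt_simpl; ring).
assert (hQ0 : h (sp j r) = 0) by (rewrite hQ; unfold h; generalize (sp i t); intros; pt_simpl; ring).
(* A side with an interior point at height 0 has one end below 0, and its other end, being positive,
   has height at least [L]; so its point at height [del] is interior too. *)
assert (inside : forall k s ds, (k < d)%nat -> 0 < s < 1 -> h (sp k s) = 0 ->
  sg * cross u (E k) * ds = del -> 0 < s + ds < 1).
{ intros k s ds hk hs h0 hd. rewrite hsp in h0.
  pose proof (nov' k ltac:(lia)) as n1. pose proof (nov' (S k) hk) as n2. rewrite hS in n2.
  set (c := sg * cross u (E k)) in *. set (a := h (vert d v k)) in *. clearbody a c.
  destruct (Rlt_dec 0 c) as [p|p].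
  - assert (L <= a + c) by (destruct (Rle_dec L (a + c)); [assumption | exfalso; apply n2; split; nra]).
    split; [assert (0 < ds) by nra; lra | assert (0 < c * (1 - s - ds)) by nra; nra].
  - assert (c < 0) by (destruct (Req_dec c 0) as [e|e]; [rewrite e in hd; lra | lra]).
    assert (L <= a) by (destruct (Rle_dec L a); [assumption | exfalso; apply n1; split; nra]).
    split; [assert (0 < - c * (s + ds)) by nra; nra | assert (ds < 0) by nra; lra]. }
assert (hi' : 0 < t + di < 1) by (apply (inside i); auto).
assert (hj' : 0 < r + dj < 1) by (apply (inside j); auto).
split; [exact hi'|]. split; [exact hj'|].
assert (hP1 : h (sp i (t + di)) = del) by (rewrite hsp in *; lra).
assert (hQ1 : h (sp j (r + dj)) = del) by (rewrite hsp in *; lra).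
assert (cr : forall w w', h w = h w' -> cross u (vsub w w') = 0).
{ intros w w' e. transitivity ((sg * sg) * cross u (vsub w w')); [rewrite sg2; ring|].
  transitivity (sg * (h w - h w')); [|rewrite e; ring].
  unfold h. generalize (sp i t); intros; pt_simpl; ring. }
set (P := sp i t) in *. set (Q := sp j r) in *. set (P' := sp i (t + di)) in *. set (Q' := sp j (r + dj)) in *.
set (tau' := dot (vsub Q' P') u).
assert (QP : dot (vsub Q P) u = tau).
{ rewrite hQ. transitivity (tau * dot u u); [generalize P; intros; pt_simpl; ring | rewrite un; ring]. }
assert (tp : 0 < tau').
{ pose proof (sides_keep_order j i r (r + dj) t (t + di) u hj hi ltac:(auto) ltac:(lra) ltac:(lra) ltac:(lra) ltac:(lra) un
    (cr _ _ (eq_trans hQ0 (eq_sym hP))) (cr _ _ (eq_trans hQ1 (eq_sym hP1)))) as o.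
  fold P Q P' Q' in o. rewrite QP in o. fold tau' in o. nra. }
assert (back : forall a b : pt, cross u (vsub b a) = 0 -> b = vadd a (vscale (dot (vsub b a) u) u)).
{ intros a b e. pose proof (parallel_eq u (vsub b a) un e) as e'.
  rewrite <- e'. pt_simpl; f_equal; ring. }
exists tau'. split; [exact tp|]. split; [apply back, cr; congruence|].
intros s hs [k [hk [t1 [ht1 hX]]]].
change (vadd (vert d v k) (vscale t1 (edge_vec d v k))) with (sp k t1) in hX.
assert (hX1 : h (sp k t1) = del).
{ rewrite <- hX, <- hP1. unfold h. generalize P' P; intros; pt_simpl; ring. }
assert (XP : dot (vsub (sp k t1) P') u = s).
{ rewrite <- hX. transitivity (s * dot u u); [generalize P'; intros; pt_simpl; ring | rewrite un; ring]. }
assert (XQ : dot (vsub (sp k t1) Q') u = s - tau').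
{ rewrite <- XP. unfold tau'. generalize P' Q' (sp k t1); intros; pt_simpl; ring. }
assert (same : forall s', 0 < s' < 1 -> sg * cross u (E k) <> 0 -> h (sp k s') = del -> sp k t1 = sp k s').
{ intros s' _ c e. rewrite hsp in e, hX1. f_equal. apply (Rmult_eq_reg_r (sg * cross u (E k))); lra. }
destruct (Nat.eq_dec k i) as [->|ni].
{ rewrite (same (t + di)) in XP; auto.
  - fold P' in XP. replace (dot (vsub P' P') u) with 0 in XP by (generalize P'; intros; pt_simpl; ring). lra.
  - intros c; rewrite c in hdi; lra. }
destruct (Nat.eq_dec k j) as [->|nj].
{ rewrite (same (r + dj)) in XQ; auto.
  - fold Q' in XQ. replace (dot (vsub Q' Q') u) with 0 in XQ by (generalize Q'; intros; pt_simpl; ring). lra.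
  - intros c; rewrite c in hdj; lra. }
(* A side blocking the displaced flight at height [del] has no end in the strip, hence also reaches
   height 0. By the constant order it would there lie between the ends of the original flight and
   block it. *)
assert (ex : exists t2, 0 <= t2 <= 1 /\ h (sp k t2) = 0).
{ rewrite hsp in hX1. pose proof (nov' k ltac:(lia)) as n1. pose proof (nov' (S k) hk) as n2. rewrite hS in n2.
  assert (hsp' : forall s, h (sp k s) = h (vert d v k) + s * (sg * cross u (E k))) by (intros; apply hsp).
  set (c := sg * cross u (E k)) in *. set (a := h (vert d v k)) in *. clearbody a c.
  assert (alt : (a <= 0 /\ L <= a + c) \/ (L <= a /\ a + c <= 0)).
  { destruct (Rle_dec a 0) as [l|l].
    - left. split; [exact l|]. destruct (Rle_dec L (a + c)); [assumption|]. exfalso; apply n2; split; nra.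
    - right. assert (L <= a) by (destruct (Rle_dec L a); [assumption | exfalso; apply n1; lra]).
      split; [assumption|]. destruct (Rle_dec (a + c) 0); [assumption|]. exfalso; apply n2.
      split; [lra|]. nra. }
  exists (- a / c). assert (c <> 0) by (destruct alt; lra). split.
  - destruct alt as [[l1 l2]|[l1 l2]].
    + assert (0 < c) by lra. split; [apply Rmult_le_pos; [lra | left; apply Rinv_0_lt_compat; lra]|].
      apply (Rmult_le_reg_r c); [lra|]. unfold Rdiv. rewrite Rmult_assoc, Rinv_l by lra. lra.
    + assert (0 < - c) by lra. replace (- a / c) with (a / - c) by (field; lra).
      split; [apply Rmult_le_pos; [lra | left; apply Rinv_0_lt_compat; lra]|].
      apply (Rmult_le_reg_r (- c)); [lra|]. unfold Rdiv. rewrite Rmult_assoc, Rinv_l by lra. lra.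
  - rewrite hsp'. field. assumption. }
destruct ex as [t2 [ht2 hX0]].
pose proof (sides_keep_order k i t2 t1 t (t + di) u hk hi ni ht2 ht1 ht hi' un
  (cr _ _ (eq_trans hX0 (eq_sym hP))) (cr _ _ (eq_trans hX1 (eq_sym hP1)))) as o1.
pose proof (sides_keep_order k j t2 t1 r (r + dj) u hk hj nj ht2 ht1 hr hj' un
  (cr _ _ (eq_trans hX0 (eq_sym hQ0))) (cr _ _ (eq_trans hX1 (eq_sym hQ1)))) as o2.
fold P P' in o1. fold Q Q' in o2. rewrite XP in o1. rewrite XQ in o2.
assert (rel : dot (vsub (sp k t2) Q) u = dot (vsub (sp k t2) P) u - tau).
{ rewrite <- QP. generalize P Q (sp k t2); intros; pt_simpl; ring. }
rewrite rel in o2.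
apply (clear (dot (vsub (sp k t2) P) u)).
- split; nra.
- rewrite <- back by (apply cr; congruence). exists k. split; [exact hk|]. exists t2. split; [exact ht2 | reflexivity].
Qed.

End Strip.

Lemma finite_gap (e : nat -> R) (c : R) n :
  exists eps, 0 < eps /\ forall k, (k < n)%nat -> e k <> c -> eps <= Rabs (e k - c).
Proof.
induction n as [|n [eps [he H]]].
- exists 1. split; [lra | lia].
- destruct (Req_dec (e n) c) as [h|h].
  + exists eps. split; [exact he|]. intros k hk ne.
    destruct (Nat.eq_dec k n) as [->|nk]; [contradiction | apply H; [lia | exact ne]].
  + assert (0 < Rabs (e n - c)) by (apply Rabs_pos_lt; lra).
    exists (Rmin eps (Rabs (e n - c))). split; [now apply Rmin_pos|]. intros k hk ne.
    destruct (Nat.eq_dec k n) as [->|nk]; [apply Rmin_r|].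
    apply Rle_trans with eps; [apply Rmin_l | apply H; [lia | exact ne]].
Qed.

Lemma finite_gap2 (e : nat -> nat -> R) (c : R) n m :
  exists eps, 0 < eps /\ forall k w, (k < n)%nat -> (w < m)%nat -> e k w <> c -> eps <= Rabs (e k w - c).
Proof.
induction m as [|m [eps [he H]]].
- exists 1. split; [lra | lia].
- destruct (finite_gap (fun k => e k m) c n) as [eps' [he' H']].
  exists (Rmin eps eps'). split; [now apply Rmin_pos|]. intros k w hk hw ne.
  destruct (Nat.eq_dec w m) as [->|nw].
  + apply Rle_trans with eps'; [apply Rmin_r | now apply H'].
  + apply Rle_trans with eps; [apply Rmin_l | apply H; auto; lia].
Qed.

(** * Cylinders as families of displaced orbits *)

Section Cylinders.
Variables (d : nat) (v : nat -> pt).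
Hypothesis Hsimple : simple_polygon d v.

Let E := edge_vec d v.
Let PO := is_periodic_orbit d v 1.

(** The length of the side projected across the direction of flight, so a transverse displacement
    [del] moves [pos] by [del / width p] up to sign. *)
Definition width (p : phase) : R := cross (edge_vec d v (side p)) (out_dir d v p).

(* The parallel orbit at signed distance [del]; the side on which it lies alternates at each bounce. *)
Definition displaced (x : nat -> phase) (del : R) : nat -> phase :=
  fun k => mkPh (side (x k)) (pos (x k) + (-1) ^ k * del / width (x k)) (ang (x k)).

Lemma displaced_0 x : displaced x 0 = x.
Proof.
apply functional_extensionality; intros k. unfold displaced.
destruct (x k) as [i t a]; simpl. f_equal. unfold Rdiv. ring.
Qed.

Lemma displaced_add x a b : displaced (displaced x a) b = displaced x (a + b).
Proof.
apply functional_extensionality; intros k. unfold displaced; simpl. f_equal.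
change (width _) with (width (x k)) at 2. unfold Rdiv. ring.
Qed.

Lemma orbit_width_pos x k : PO x -> 0 < width (x k).
Proof.
intros [h _]. assert (hp : in_phase d (x k)) by apply h. unfold width. rewrite out_dir_cross by assumption.
apply Rmult_lt_0_compat; [apply edge_norm_pos, hp | apply (in_phase_cos d), hp]; assumption.
Qed.

(** At [lam = 1] the reflection preserves the angle with the normal, so the side has the same width
    for the arriving and for the leaving direction. *)
Lemma orbit_width_next x k : PO x ->
  cross (out_dir d v (x k)) (E (side (x (S k)))) = width (x (S k)).
Proof.
intros [h _]. destruct (step_incidence d v Hsimple _ _ _ (h k)) as [_ [ha [_ h2]]].
rewrite Rmult_1_l in ha. rewrite <- ha in h2. assert (hp : in_phase d (x (S k))) by apply h.
unfold width. rewrite out_dir_cross by assumption.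
transitivity (- cross (edge_vec d v (side (x (S k)))) (out_dir d v (x k))).
- unfold cross, E; ring.
- rewrite h2. ring.
Qed.

(** Crossing the two flight equations with the common direction removes the flight lengths and
    leaves a transverse offset that only changes sign from one bounce to the next. This reduces
    [cyl_rel] to one real parameter, so that its symmetry and transitivity become facts about
    intervals. *)
Lemma cyl_rel_displaced x y : cyl_rel d v x y ->
  exists del, y = displaced x del /\ forall s, 0 <= s <= 1 -> PO (displaced x (s * del)).
Proof.
intros [hx [hy [hs [ha hi]]]].
set (D := fun k => pos (y k) - pos (x k)).
assert (same : forall k, out_dir d v (y k) = out_dir d v (x k)).
{ intros k. unfold out_dir. now rewrite hs, ha. }
assert (rec : forall k, D (S k) * width (x (S k)) = - (D k * width (x k))).
{ intros k. pose proof (orbit_width_next x k hx) as w1.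
  destruct hx as [hx _]. destruct hy as [hy _].
  destruct (hx k) as [_ [_ [t [_ [p _]]]]]. destruct (hy k) as [_ [_ [t' [_ [p' _]]]]].
  rewrite same in p'. unfold ph_point in p, p'. rewrite <- (hs k), <- (hs (S k)) in p'.
  rewrite <- w1. unfold D, width. fold (E (side (x k))) (E (side (x (S k)))) in *.
  revert p p'. generalize (vert d v (side (x k))) (vert d v (side (x (S k)))) (E (side (x k))) (E (side (x (S k))))
    (out_dir d v (x k)) (pos (x k)) (pos (x (S k))) (pos (y k)) (pos (y (S k))).
  intros [a1 a2] [b1 b2] [e1 e2] [f1 f2] [u1 u2] X X' Y Y' p p'.
  unfold vadd, vscale, cross in *; simpl in *. injection p; intros q2 q1. injection p'; intros q2' q1'.
  assert (A1 : (Y' - X') * f1 = (Y - X) * e1 + (t' - t) * u1) by lra.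
  assert (A2 : (Y' - X') * f2 = (Y - X) * e2 + (t' - t) * u2) by lra.
  transitivity (u1 * ((Y' - X') * f2) - u2 * ((Y' - X') * f1)); [ring|]. rewrite A1, A2. ring. }
assert (alt : forall k, D k * width (x k) = (-1) ^ k * (D 0%nat * width (x 0%nat))).
{ induction k as [|k IH]; [simpl; ring | rewrite rec, IH; simpl; ring]. }
set (del := D 0%nat * width (x 0%nat)) in *.
assert (ip : forall s, interp x y s = displaced x (s * del)).
{ intros s. apply functional_extensionality; intros k. unfold interp, displaced. f_equal.
  pose proof (orbit_width_pos x k hx).
  replace ((-1) ^ k * (s * del)) with (s * ((-1) ^ k * del)) by ring. rewrite <- alt. unfold D. field. lra. }
exists del. split; [|intros s h; rewrite <- ip; now apply hi].
replace del with (1 * del) by ring. rewrite <- ip.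
apply functional_extensionality; intros k. unfold interp. rewrite hs, ha.
destruct (y k); simpl. f_equal. ring.
Qed.

Lemma displaced_cyl_rel x del : (forall s, 0 <= s <= 1 -> PO (displaced x (s * del))) ->
  cyl_rel d v x (displaced x del).
Proof.
intros H.
assert (hx : PO x) by (rewrite <- (displaced_0 x); replace 0 with (0 * del) by ring; apply H; lra).
split; [exact hx|]. split; [replace del with (1 * del) by ring; apply H; lra|].
split; [intros k; reflexivity|]. split; [intros k; reflexivity|].
intros s hs. replace (interp x (displaced x del) s) with (displaced x (s * del)); [now apply H|].
apply functional_extensionality; intros k. unfold interp, displaced; simpl. f_equal. unfold Rdiv. ring.
Qed.

Lemma cyl_rel_refl x : PO x -> cyl_rel d v x x.
Proof.
intros h. rewrite <- (displaced_0 x) at 2. apply displaced_cyl_rel. intros s _. rewrite Rmult_0_r, displaced_0. exact h.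
Qed.

Lemma cyl_rel_sym x y : cyl_rel d v x y -> cyl_rel d v y x.
Proof.
intros h. destruct (cyl_rel_displaced _ _ h) as [del [-> H]].
replace x with (displaced (displaced x del) (- del)) at 2.
- apply displaced_cyl_rel. intros s hs. rewrite displaced_add.
  replace (del + s * - del) with ((1 - s) * del) by ring. apply H; lra.
- rewrite displaced_add. replace (del + - del) with 0 by ring. apply displaced_0.
Qed.

Lemma segment_convex (Q : R -> Prop) a : (forall s, 0 <= s <= 1 -> Q (s * a)) <->
  (forall r, 0 <= r <= a \/ a <= r <= 0 -> Q r).
Proof.
split; intros H.
- intros r hr. destruct (Req_dec a 0) as [->|ha].
  + replace r with (0 * 0) by lra. apply H; lra.
  + replace r with (r / a * a) by (field; exact ha). apply H.
    destruct hr as [hr|hr].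
    * assert (0 < a) by lra. split; [apply Rmult_le_pos; [lra | left; apply Rinv_0_lt_compat; lra]|].
      apply (Rmult_le_reg_r a); [lra|]. unfold Rdiv; rewrite Rmult_assoc, Rinv_l by lra. lra.
    * assert (0 < - a) by lra. replace (r / a) with (- r / - a) by (field; lra).
      split; [apply Rmult_le_pos; [lra | left; apply Rinv_0_lt_compat; lra]|].
      apply (Rmult_le_reg_r (- a)); [lra|]. unfold Rdiv; rewrite Rmult_assoc, Rinv_l by lra. lra.
- intros s hs. apply H. destruct (Rle_dec 0 a); [left | right]; nra.
Qed.

Lemma cyl_rel_trans x y z : cyl_rel d v x y -> cyl_rel d v y z -> cyl_rel d v x z.
Proof.
intros h1 h2. destruct (cyl_rel_displaced _ _ h1) as [a [-> H1]].
destruct (cyl_rel_displaced _ _ h2) as [b [-> H2]].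
rewrite displaced_add. apply displaced_cyl_rel.
rewrite (segment_convex (fun r => PO (displaced x r))) in H1.
rewrite (segment_convex (fun r => PO (displaced (displaced x a) r))) in H2.
apply (segment_convex (fun r => PO (displaced x r))). intros r hr.
assert (alt : (0 <= r <= a \/ a <= r <= 0) \/ (0 <= r - a <= b \/ b <= r - a <= 0)).
{ destruct hr; [destruct (Rle_dec r a) | destruct (Rle_dec a r)]; lra. }
destruct alt as [alt|alt]; [now apply H1|].
replace r with (a + (r - a)) by ring. rewrite <- displaced_add. now apply H2.
Qed.

Definition same_set (C C' : phase -> Prop) : Prop := forall p, C p <-> C' p.

Lemma cylinder_of_rel x y : cyl_rel d v x y -> same_set (cylinder_of d v x) (cylinder_of d v y).
Proof.
intros h p. split; intros [z [k [hz ->]]]; exists z, k; (split; [|reflexivity]).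
- apply cyl_rel_trans with x; [now apply cyl_rel_sym | exact hz].
- now apply cyl_rel_trans with y.
Qed.

Definition tail (k : nat) (x : nat -> phase) : nat -> phase := fun j => x (j + k)%nat.

Lemma cyl_rel_tail x y k : cyl_rel d v x y -> cyl_rel d v (tail k x) (tail k y).
Proof.
intros [hx [hy [hs [ha hi]]]].
split; [now apply periodic_shift|]. split; [now apply periodic_shift|].
split; [intros j; apply hs|]. split; [intros j; apply ha|].
intros s h. exact (periodic_shift d v 1 (interp x y s) k (hi s h)).
Qed.

(** By periodicity, a shift by [k] is undone by going [k * n - k] steps further. *)
Lemma cylinder_tail_sub x k p : cylinder_of d v x p -> cylinder_of d v (tail k x) p.
Proof.
intros [y [j [h ->]]]. pose proof h as [_ [[_ [n [hn hp]]] _]].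
exists (tail k y), (j + k * n - k)%nat. split; [now apply cyl_rel_tail|].
unfold tail. rewrite Nat.sub_add by nia. symmetry. now apply periodic_mult.
Qed.

Lemma cylinder_tail x k : PO x -> same_set (cylinder_of d v x) (cylinder_of d v (tail k x)).
Proof.
intros hx p. split; [apply cylinder_tail_sub|]. intros h.
destruct hx as [_ [n [hn hp]]].
apply (cylinder_tail_sub _ (k * n - k)) in h.
replace (tail (k * n - k) (tail k x)) with x in h; [exact h|].
apply functional_extensionality; intros j. unfold tail.
replace (j + (k * n - k) + k)%nat with (j + k * n)%nat by nia. symmetry. now apply periodic_mult.
Qed.

Lemma step_deterministic x y y' : pinball_step d v 1 x y -> pinball_step d v 1 x y' -> y = y'.
Proof.
intros [hx [hy [t [ht [p [c a]]]]]] [_ [hy' [t' [ht' [p' [c' a']]]]]].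
assert (onb : forall z, in_phase d z -> on_boundary d v (ph_point d v z)).
{ intros z [hz [hpz _]]. exists (side z). split; [exact hz|]. exists (pos z). split; [lra | reflexivity]. }
assert (tt : t = t').
{ destruct (Rtotal_order t t') as [l|[l|l]]; [|exact l|]; exfalso.
  - apply (c' t); [lra|]. rewrite <- p. now apply onb.
  - apply (c t'); [lra|]. rewrite <- p'. now apply onb. }
subst t'. rewrite <- p in p'.
assert (ss : side y = side y').
{ destruct (Nat.eq_dec (side y) (side y')) as [e|ne]; [exact e|]. exfalso.
  apply (open_side_disjoint d v Hsimple (side y') (side y) (pos y') (proj1 hy') (proj1 hy) ltac:(auto) (proj1 (proj2 hy'))).
  exists (pos y). destruct hy as [_ [hh _]]. split; [lra | exact p']. }
assert (pp : pos y = pos y').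
{ apply (side_point_inj d v Hsimple (side y)); [apply hy|]. unfold side_point.
  unfold ph_point in p'. rewrite <- ss in p'. now symmetry. }
rewrite <- ss, <- a in a'. destruct y, y'; simpl in *. congruence.
Qed.

(** The map is deterministic, so two member orbits through a common phase point agree from there on;
    neither dropping an initial stretch nor changing the member orbit changes the cylinder. *)
Lemma cylinder_common x y p : PO x -> PO y -> cylinder_of d v x p -> cylinder_of d v y p ->
  same_set (cylinder_of d v x) (cylinder_of d v y).
Proof.
intros hx hy [x' [j [h1 ->]]] [y' [k [h2 e]]].
pose proof h1 as [_ [hx' _]]. pose proof h2 as [_ [hy' _]].
assert (tl : tail j x' = tail k y').
{ apply functional_extensionality. induction x0 as [|i IH]; [exact e|].
  apply (step_deterministic (tail j x' i)); [apply hx'|]. rewrite IH. apply hy'. }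
intros p.
rewrite (cylinder_of_rel _ _ h1 p), (cylinder_of_rel _ _ h2 p).
rewrite (cylinder_tail x' j hx' p), (cylinder_tail y' k hy' p). now rewrite tl.
Qed.

(* The displacement at which the line of the [k]-th flight passes through vertex [w]. *)
Definition hit (x : nat -> phase) (k w : nat) : R :=
  (-1) ^ S k * cross (out_dir d v (x k)) (vsub (vert d v w) (ph_point d v (x k))).

Lemma displaced_point x del k : ph_point d v (displaced x del k) =
  vadd (ph_point d v (x k)) (vscale ((-1) ^ k * del / width (x k)) (E (side (x k)))).
Proof.
unfold ph_point, displaced; simpl. fold (E (side (x k))).
generalize (vert d v (side (x k))) (E (side (x k))) ((-1) ^ k * del / width (x k)).
intros; pt_simpl; f_equal; ring.
Qed.

Lemma cross_width (x : nat -> phase) k : cross (out_dir d v (x k)) (E (side (x k))) = - width (x k).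
Proof. unfold width, cross. fold E. ring. Qed.

Lemma hit_displaced x del k w : PO x -> hit (displaced x del) k w = hit x k w - del.
Proof.
intros hx. unfold hit. rewrite displaced_point. change (out_dir d v (displaced x del k)) with (out_dir d v (x k)).
pose proof (orbit_width_pos x k hx) as wp. pose proof (cross_width x k) as cw.
set (c := (-1) ^ k * del / width (x k)).
replace (cross _ _) with (cross (out_dir d v (x k)) (vsub (vert d v w) (ph_point d v (x k)))
  - c * cross (out_dir d v (x k)) (E (side (x k))))
  by (generalize (vert d v w) (ph_point d v (x k)) (out_dir d v (x k)) (E (side (x k))) c; intros; pt_simpl; ring).
rewrite cw. unfold c. simpl. transitivity (-1 * (-1) ^ k *
  cross (out_dir d v (x k)) (vsub (vert d v w) (ph_point d v (x k))) - ((-1) ^ k * (-1) ^ k) * del).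
- field. lra.
- rewrite pow_m1_sqr. ring.
Qed.

Lemma hit_periodic (x : nat -> phase) n k w : (forall k, x (k + n)%nat = x k) -> hit x (k + 2 * n) w = hit x k w.
Proof.
intros hp. unfold hit. rewrite (periodic_mult _ x n 2 k hp).
replace (S (k + 2 * n)) with (S k + 2 * n)%nat by lia. rewrite pow_add, pow_1_even. ring.
Qed.

Lemma displaced_extends x L del : PO x ->
  (forall k w, (w < d)%nat -> ~ 0 < hit x k w < L) -> 0 < del < L -> PO (displaced x del).
Proof.
intros hx nov hdel. pose proof hx as [hst [n [hn hp]]]. split.
- intros k. pose proof (hst k) as st. pose proof (step_sides d v Hsimple _ _ _ st) as ne.
  pose proof (orbit_width_pos x k hx) as w1. pose proof (orbit_width_pos x (S k) hx) as w2.
  pose proof (orbit_width_next x k hx) as wn. pose proof (cross_width x k) as wc.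
  destruct st as [h1 [h2 [tau [ht [hpt [clear ha]]]]]].
  pose proof (out_dir_unit d v Hsimple _ h1) as un.
  set (u := out_dir d v (x k)) in *.
  pose proof (strip_extension d v Hsimple (side (x k)) (side (x (S k))) (pos (x k)) (pos (x (S k))) u tau
    ((-1) ^ S k) L del ((-1) ^ k * del / width (x k)) ((-1) ^ S k * del / width (x (S k)))
    (proj1 h1) (proj1 h2) ne (proj1 (proj2 h1)) (proj1 (proj2 h2)) un (pow_m1_sqr (S k)) ht hpt clear
    (fun w hw => nov k w hw) hdel) as ext.
  fold (E (side (x k))) (E (side (x (S k)))) in ext. rewrite wc, wn in ext.
  destruct ext as [i1 [i2 [tau' [ht' [hpt' clear']]]]].
  + simpl. transitivity ((-1) ^ k * (-1) ^ k * del); [field; lra | rewrite pow_m1_sqr; ring].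
  + transitivity ((-1) ^ S k * (-1) ^ S k * del); [field; lra | rewrite pow_m1_sqr; ring].
  + split; [split; [apply h1 | split; [exact i1 | apply h1]]|].
    split; [split; [apply h2 | split; [exact i2 | apply h2]]|].
    exists tau'. split; [exact ht'|]. split; [exact hpt'|]. split; [exact clear' | exact ha].
(* The displacement alternates in sign, so an odd period has to be doubled. *)
- exists (2 * n)%nat. split; [lia|]. intros k. unfold displaced.
  rewrite (periodic_mult _ x n 2 k hp). f_equal. rewrite pow_add, pow_1_even. f_equal. unfold Rdiv. ring.
Qed.

(** [hit] has period [2 * n] in [k], so it takes finitely many values, and those other than [c] keep
    a positive distance from it. *)
Lemma hit_gap x c : PO x -> exists eps, 0 < eps /\
  forall k w, (w < d)%nat -> hit x k w <> c -> eps <= Rabs (hit x k w - c).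
Proof.
intros [_ [n [hn hp]]]. destruct (finite_gap2 (hit x) c (2 * n) d) as [eps [he H]].
exists eps. split; [exact he|]. intros k w hw.
assert (e : hit x k w = hit x (k mod (2 * n)) w).
{ rewrite (Nat.div_mod k (2 * n)) at 1 by lia. rewrite Nat.add_comm.
  induction (k / (2 * n))%nat as [|m IH]; [f_equal; lia|].
  rewrite <- IH. replace (k mod (2 * n) + 2 * n * S m)%nat with ((k mod (2 * n) + 2 * n * m) + 2 * n)%nat by lia.
  now apply hit_periodic. }
rewrite e. apply H; [apply Nat.mod_upper_bound; lia | exact hw].
Qed.

Lemma cylinder_end x : PO x -> exists dl, 0 < dl /\
  (forall k r, 0 <= r < dl -> cylinder_of d v x (displaced x r k)) /\
  exists k w, (w < d)%nat /\ hit x k w = dl.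
Proof.
intros hx.
set (A := fun del => 0 <= del /\ forall r, 0 <= r <= del -> PO (displaced x r)).
assert (A0 : A 0) by (split; [lra|]; intros r hr; replace r with 0 by lra; now rewrite displaced_0).
assert (bd : bound A).
(* Displacing by the full width of the first side would push the position past 1. *)
{ exists (width (x 0%nat)). intros del [h0 H]. pose proof (orbit_width_pos x 0 hx) as wp.
  destruct (H del ltac:(lra)) as [st _]. destruct (st 0%nat) as [[_ [hp _]] _].
  unfold displaced in hp; simpl in hp. destruct hx as [st' _]. destruct (st' 0%nat) as [[_ [hp' _]] _].
  assert (h : del / width (x 0%nat) < 1) by lra.
  apply (Rmult_lt_compat_r (width (x 0%nat))) in h; [|exact wp].
  unfold Rdiv in h. rewrite Rmult_assoc, Rinv_l in h by lra. lra. }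
destruct (completeness A bd (ex_intro _ 0 A0)) as [dl [ub lub]].
assert (inA : forall r, 0 <= r < dl -> A r).
{ intros r hr. destruct (classic (exists del, A del /\ r < del)) as [[del [[h0 H] h1]]|no].
  - split; [lra|]. intros r' h'. apply H; lra.
  - exfalso. assert (dl <= r); [|lra]. apply lub. intros del hdel.
    destruct (Rle_dec del r) as [l|l]; [exact l|]. exfalso. apply no. exists del. split; [exact hdel | lra]. }
assert (pos_dl : 0 < dl).
{ destruct (hit_gap x 0 hx) as [eps [he H]].
  assert (Ae : A (eps / 2)).
  { split; [lra|]. intros r hr. destruct (Req_dec r 0) as [->|nr]; [now rewrite displaced_0|].
    apply (displaced_extends x eps); [exact hx | | lra].
    intros k w hw [g1 g2]. specialize (H k w hw ltac:(lra)). rewrite Rabs_right in H; lra. }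
  apply ub in Ae. lra. }
exists dl. split; [exact pos_dl|]. split.
- intros k r hr. exists (displaced x r), k. split; [|reflexivity].
  apply displaced_cyl_rel. intros s hs. destruct (inA r hr) as [_ H]. apply H. nra.
(* If the boundary orbit met no vertex, a margin around [dl] would be free of vertices, and the
   extension from a displacement [r1] just below [dl] would carry the family past its supremum. *)
- apply NNPP. intros no.
  destruct (hit_gap x dl hx) as [eps [he H]].
  set (r1 := Rmax 0 (dl - eps / 2)).
  assert (hr1 : 0 <= r1 < dl /\ dl - eps < r1).
  { unfold r1, Rmax. destruct (Rle_dec 0 (dl - eps / 2)); lra. }
  destruct (inA r1 (proj1 hr1)) as [_ P1].
  assert (hx1 : PO (displaced x r1)) by (apply P1; lra).
  assert (Ae : A (dl + eps / 2)).
  { split; [lra|]. intros r hr. destruct (Rle_dec r r1) as [l|l]; [apply P1; lra|].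
    replace r with (r1 + (r - r1)) by ring. rewrite <- displaced_add.
    apply (displaced_extends _ (dl + eps - r1)); [exact hx1 | | lra].
    intros k w hw. rewrite hit_displaced by exact hx. intros [g1 g2].
    assert (nd : hit x k w <> dl) by (intros e; apply no; now exists k, w).
    specialize (H k w hw nd). unfold Rabs in H. destruct (Rcase_abs (hit x k w - dl)); lra. }
  apply ub in Ae. lra.
Qed.

(* Just left of the flight of the boundary orbit that passes through the vertex, the two cylinders
   contain a common phase point. *)
Lemma cylinder_determined x x' k k' w dl dl' : PO x -> PO x' ->
  0 < dl -> (forall r, 0 <= r < dl -> cylinder_of d v x (displaced x r k)) ->
  0 < dl' -> (forall r, 0 <= r < dl' -> cylinder_of d v x' (displaced x' r k')) ->
  hit x k w = dl -> hit x' k' w = dl' ->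
  side (x k) = side (x' k') -> ang (x k) = ang (x' k') -> (-1) ^ k = (-1) ^ k' ->
  same_set (cylinder_of d v x) (cylinder_of d v x').
Proof.
intros hx hx' h1 c1 h2 c2 e1 e2 hs ha hk.
set (eta := Rmin dl dl' / 2).
assert (he : 0 < eta /\ eta <= dl / 2 /\ eta <= dl' / 2).
{ unfold eta. pose proof (Rmin_l dl dl'). pose proof (Rmin_r dl dl'). pose proof (Rmin_pos _ _ h1 h2). lra. }
apply (cylinder_common x x' (displaced x (dl - eta) k)); auto; [apply c1; lra|].
replace (displaced x (dl - eta) k) with (displaced x' (dl' - eta) k'); [apply c2; lra|].
unfold displaced. rewrite hs, ha. f_equal.
pose proof (orbit_width_pos x k hx) as wp. pose proof (cross_width x k) as cw.
assert (uu : out_dir d v (x' k') = out_dir d v (x k)) by (unfold out_dir; now rewrite hs, ha).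
assert (ww : width (x' k') = width (x k)) by (unfold width; now rewrite hs, uu).
rewrite ww, <- e1, <- e2, <- hk. unfold hit. rewrite uu. simpl. rewrite <- hk.
unfold ph_point. rewrite <- hs. fold (E (side (x k))).
set (u := out_dir d v (x k)) in *. set (e := (-1) ^ k) in *.
assert (e2' : e * e = 1) by apply pow_m1_sqr.
assert (lin : forall t, cross u (vsub (vert d v w) (vadd (vert d v (side (x k))) (vscale t (E (side (x k)))))) =
  cross u (vsub (vert d v w) (vert d v (side (x k)))) + t * width (x k)).
{ intros t. rewrite <- (Ropp_involutive (width (x k))), <- cw.
  generalize (vert d v w) (vert d v (side (x k))) (E (side (x k))) u; intros; pt_simpl; ring. }
rewrite !lin. set (c := cross u (vsub (vert d v w) (vert d v (side (x k))))).
(* The position [t] of the reference orbit cancels: the displaced point is fixed by its distance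
   [eta] from the line through the vertex. *)
assert (g : forall t, t + e * (-1 * e * (c + t * width (x k)) - eta) / width (x k) = - c / width (x k) - e * eta / width (x k)).
{ intros t. transitivity (t - (e * e) * (c + t * width (x k)) / width (x k) - e * eta / width (x k)); [field; lra|].
  rewrite e2'. field. lra. }
now rewrite !g.
Qed.

End Cylinders.

(** * Roots of unity in number fields *)

Module RootsOfUnity.
Import all_boot all_order all_algebra all_field complex algebra_tactics.ring.
Import GRing.Theory Num.Theory.
Open Scope ring_scope.

Lemma ratr_map_intr (F : numFieldType) (p : {poly int}) :
  map_poly (ratr : rat -> F) (map_poly intr p) = map_poly intr p.
Proof. by rewrite -map_poly_comp; apply: eq_map_poly => x /=; rewrite ratr_int. Qed.

Lemma root_prod_seq (F : idomainType) (I : eqType) (r : seq I) (p : I -> {poly F}) x :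
  root (\prod_(i <- r) p i) x = has (fun i => root (p i) x) r.
Proof.
elim: r => [|i r IH]; first by rewrite big_nil rootE hornerC oner_eq0.
by rewrite big_cons rootM IH.
Qed.

(** Since [X^N - 1] is the product of the cyclotomic polynomials of the divisors of [N], [z] is a
    root of one of them, say of index [d]. Then [z ^+ d = 1], and primitivity forces [d = N]. *)
Lemma prim_root_Phi (F : numFieldType) (N : nat) (z : F) :
  N.-primitive_root z -> root (map_poly intr 'Phi_N) z.
Proof.
move=> prim; have N0 := prim_order_gt0 prim.
have: root (map_poly intr (\prod_(d <- divisors N) 'Phi_d)) z.
  rewrite prod_Cyclotomic // rmorphB rmorph1 /= map_polyXn rootE !hornerE.
  by rewrite prim_expr_order ?subrr.
rewrite rmorph_prod /= root_prod_seq => /hasP[d dN rootd].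
move: dN; rewrite -dvdn_divisors // => dN.
have d0 : (0 < d)%N by apply: dvdn_gt0 dN.
suff : z ^+ d = 1.
  move/eqP; rewrite -(prim_order_dvd prim) => Nd.
  by have /eqP <- : d == N by rewrite eqn_dvd dN.
have: root (map_poly intr (\prod_(e <- divisors d) 'Phi_e)) z.
  rewrite rmorph_prod /= root_prod_seq; apply/hasP; exists d => //.
  by rewrite -dvdn_divisors.
rewrite prod_Cyclotomic // rmorphB rmorph1 /= map_polyXn rootE !hornerE.
by rewrite subr_eq0 => /eqP.
Qed.

(** The minimal polynomial of a primitive root is computed in [algC]. The rational gcd of [P] and
    the cyclotomic polynomial is not constant, as [z] is a root of it; it therefore has a root [w]
    in [algC], again primitive of order [N], whose minimal polynomial divides [P]. *)
Lemma totient_lt_size_annihilator (F : numFieldType) (N : nat) (z : F)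
    (P : {poly rat}) :
  N.-primitive_root z -> P != 0 -> root (map_poly ratr P) z ->
  (totient N < size P)%N.
Proof.
move=> prim P0 rootP; have N0 := prim_order_gt0 prim.
pose Q : {poly rat} := map_poly intr 'Phi_N.
have rootQ : root (map_poly ratr Q) z by rewrite ratr_map_intr prim_root_Phi.
have Q0 : size Q = (totient N).+1.
  rewrite size_map_poly_id0 ?size_Cyclotomic // intr_eq0 lead_coef_eq0.
  by rewrite -size_poly_eq0 size_Cyclotomic.
pose g := gcdp P Q.
have rootg : root (map_poly ratr g) z by rewrite gcdp_map root_gcd rootP rootQ.
have sg : size (map_poly ratr g : {poly algC}) != 1%N.
  rewrite size_map_poly; apply/negP => /size_poly1P[c c0 E].
  by move: rootg; rewrite E map_polyC rootC fmorph_eq0 (negPf c0).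
have [w rw] := closed_rootP _ sg.
have primw : N.-primitive_root w.
  have : root (map_poly ratr Q) w.
    have := dvdp_gcdr P Q; rewrite -(dvdp_map (@ratr algC)).
    by move/dvdpP=> [r ->]; rewrite rootM rw orbT.
  have [u pu] := C_prim_root_exists N0.
  by rewrite ratr_map_intr (Cintr_Cyclotomic pu) root_cyclotomic.
have [m [Em mm] mP] := minCpolyP w.
have : root (map_poly ratr P) w.
  have := dvdp_gcdl P Q; rewrite -(dvdp_map (@ratr algC)).
  by move/dvdpP=> [r ->]; rewrite rootM rw orbT.
rewrite mP => mdP.
have := dvdp_leq P0 mdP; suff -> : size m = (totient N).+1 by [].
have := congr1 (fun p : {poly algC} => size p) Em.
by rewrite (minCpoly_cyclotomic primw) size_cyclotomic size_map_poly => <-.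
Qed.

(** A prime power [p ^ k] exactly dividing [N] is at most twice its totient, because
    [p <= 2 * (p - 1)], hence at most [2 * B]; so it divides the factorial, and together these prime
    powers make up [N]. *)
Lemma dvdn_fact_totient (N B : nat) : (0 < N)%N -> (totient N <= B)%N ->
  (N %| (B.*2)`!)%N.
Proof.
move=> N0 tB; apply/dvdn_partP => // p.
rewrite mem_primes => /and3P[pp _ pN].
rewrite p_part; set k := logn p N.
have k0 : (0 < k)%N by rewrite logn_gt0 mem_primes pp N0 pN.
apply: dvdn_fact; rewrite expn_gt0 prime_gt0 //=.
have tp : (totient (p ^ k) <= B)%N.
  apply: leq_trans tB.
  have [m cop E] := pfactor_coprime pp N0.
  rewrite -/k in E; rewrite [X in (_ <= totient X)%N]E totient_coprime 1?coprime_sym ?coprimeXl // leq_pmull // totient_gt0.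
  by move: N0; rewrite {1}E muln_gt0 => /andP[].
apply: leq_trans (_ : (totient (p ^ k)).*2 <= B.*2)%N; last by rewrite leq_double.
rewrite totient_pfactor // -[X in (p ^ X)%N](prednK k0) expnS -muln2 mulnAC.
rewrite leq_mul2r; apply/orP; right.
by case: p pp {pN k k0 tp} => [|[|p]] // _; rewrite muln2 -addnn addSn addnS !ltnS leq_addl.
Qed.

(** * Finite-dimensional rational algebras *)

Inductive Qspan {F : numFieldType} (l : seq F) : F -> Prop :=
| Qspan0 : Qspan l 0
| QspanS q g x : g \in l -> Qspan l x -> Qspan l (ratr q * g + x).

Section QspanTheory.
Variable F : numFieldType.
Implicit Types (l : seq F) (x y : F).

Lemma QspanD l x y : Qspan l x -> Qspan l y -> Qspan l (x + y).
Proof.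
move=> sx sy; elim: sx => [|q g z gl _ IH]; first by rewrite add0r.
by rewrite -addrA; apply: QspanS.
Qed.

Lemma QspanZ l q x : Qspan l x -> Qspan l (ratr q * x).
Proof.
elim=> [|r g z gl _ IH]; first by rewrite mulr0; constructor.
by rewrite mulrDr mulrA -rmorphM; apply: QspanS.
Qed.

Lemma Qspan_gen l x : x \in l -> Qspan l x.
Proof.
move=> xl; rewrite -[x]addr0 -[x]mul1r -(rmorph1 (ratr : rat -> F)).
by apply: QspanS => //; constructor.
Qed.

Lemma Qspan_sum l (I : Type) (r : seq I) (P : pred I) (f : I -> F) :
  (forall i, P i -> Qspan l (f i)) -> Qspan l (\sum_(i <- r | P i) f i).
Proof. by move=> H; apply: big_ind => //; [constructor | exact: QspanD]. Qed.

Lemma Qspan_mulr l l' a x : (forall g, g \in l -> Qspan l' (g * a)) ->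
  Qspan l x -> Qspan l' (x * a).
Proof.
move=> H; elim=> [|q g z gl _ IH]; first by rewrite mul0r; constructor.
by rewrite mulrDl -mulrA; apply: QspanD => //; apply: QspanZ; apply: H.
Qed.

Lemma Qspan_coord l x : Qspan l x ->
  exists c : 'rV[rat]_(size l), x = \sum_i ratr (c 0 i) * l`_i.
Proof.
elim=> [|q g z gl _ [c ->]].
  by exists 0; rewrite big1 // => i _; rewrite mxE rmorph0 mul0r.
have gi : (index g l < size l)%N by rewrite index_mem.
exists (q *: delta_mx 0 (Ordinal gi) + c).
under [RHS]eq_bigr => i _ do rewrite !mxE rmorphD mulrDl rmorphM.
rewrite big_split /=; congr (_ + _); rewrite (bigD1 (Ordinal gi)) //= !eqxx.
rewrite rmorph1 mulr1 nth_index // big1 ?addr0 // => i /negPf ->.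
by rewrite rmorph0 mulr0 mul0r.
Qed.

(** The condition, checked on generators, under which the span is a subring; the length of [l]
    bounds its rational dimension. *)
Definition Qring l := Qspan l 1 /\ forall g h, g \in l -> h \in l -> Qspan l (g * h).

Lemma QringM l x y : Qring l -> Qspan l x -> Qspan l y -> Qspan l (x * y).
Proof.
move=> [_ H] sx sy; apply: Qspan_mulr sx => g gl; rewrite mulrC.
by apply: Qspan_mulr sy => h hl; apply: H.
Qed.

(** With the leading coefficient inverted among the rationals, [p] expresses [a ^+ D] through lower
    powers; the products of the generators with the powers below [D] therefore suffice. *)
Lemma Qring_adjoin l a (p : {poly int}) :
  Qring l -> p != 0 -> root (map_poly intr p) a ->
  exists2 l', Qring l' & {in l, forall g, Qspan l' g} /\ Qspan l' a.
Proof.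
move=> rl p0 rp; set D := (size p).-1.
have sp : size p = D.+1 by rewrite prednK // lt0n size_poly_eq0.
pose q i : rat := - ((p`_i)%:~R / (lead_coef p)%:~R).
have aD : a ^+ D = \sum_(i < D) ratr (q i) * a ^+ i.
  move: rp; rewrite rootE horner_coef size_map_poly_id0; last first.
    by rewrite intr_eq0 lead_coef_eq0.
  rewrite sp big_ord_recr /= => /eqP /(canRL (addKr _)).
  rewrite addr0 !coef_map /= -[p`_D]/(lead_coef p) => E.
  have c0 : ((lead_coef p)%:~R : F) != 0 by rewrite intr_eq0 lead_coef_eq0.
  apply: (mulfI c0); rewrite /lead_coef -/D E -sumrN mulr_sumr.
  apply: eq_bigr => i _; rewrite !coef_map /= /q rmorphN fmorph_div /= !ratr_int.
  by rewrite /lead_coef -/D; field.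
pose l' := [seq g * a ^+ k | g <- l, k <- iota 0 D].
have gen g k : g \in l -> Qspan l' (g * a ^+ k).
  move=> gl; elim/ltn_ind: k => k IH.
  have [kD|Dk] := ltnP k D.
    by apply/Qspan_gen/allpairsP; exists (g, k); rewrite mem_iota.
  rewrite -(subnK Dk) exprD aD mulr_sumr mulr_sumr.
  apply: Qspan_sum => i _.
  have -> : g * (a ^+ (k - D) * (ratr (q i) * a ^+ i)) =
            ratr (q i) * (g * a ^+ (k - D + i)) by rewrite exprD; ring.
  apply/QspanZ/IH.
  by rewrite -{2}(subnK Dk) ltn_add2l.
have gen' x k : Qspan l x -> Qspan l' (x * a ^+ k).
  by move=> sx; apply: Qspan_mulr sx => g gl; apply: gen.
exists l'; last split.
- split=> [|g h]; first by rewrite -[1]mulr1 -(expr0 a); apply: gen'; case: rl.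
  move=> /allpairsP[[g1 i] /= [gl _ ->]] /allpairsP[[h1 j] /= [hl _ ->]].
  by rewrite mulrACA -exprD; apply: gen'; case: rl => _; apply.
- by move=> g gl; rewrite -[g]mulr1 -(expr0 a); apply: gen.
- by rewrite -[a]mul1r -[X in 1 * X](expr1 a); apply: gen'; case: rl.
Qed.

Lemma Qring_exists (s : seq F) :
  (forall a, a \in s -> exists2 p : {poly int}, p != 0 & root (map_poly intr p) a) ->
  exists2 l, Qring l & {in s, forall a, Qspan l a}.
Proof.
elim: s => [|a s IH] H.
  have s1 : Qspan [:: (1 : F)] 1 by apply: Qspan_gen; rewrite inE.
  by exists [:: 1] => //; split=> // g h; rewrite !inE => /eqP-> /eqP->; rewrite mulr1.
have [|l rl sl] := IH; first by move=> b bs; apply: H; rewrite inE bs orbT.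
have [|p p0 rp] := H a; first by rewrite inE eqxx.
have [l' rl' [ll' al']] := Qring_adjoin l a p rl p0 rp.
exists l' => // b; rewrite inE => /orP[/eqP->//|bs].
by rewrite -[b]mulr1; apply: Qspan_mulr (sl b bs) => g /ll'; rewrite mulr1.
Qed.

End QspanTheory.

Local Notation Re := complex.Re.
Local Notation Im := complex.Im.

(** Real and imaginary parts give each [x k] a coordinate row of length [m]. Of [m.+1] such rows
    some rational combination vanishes, and [P] has its coefficients. *)
Lemma Qspan_dependent (F : rcfType) (l : seq F) (x : nat -> F[i]) :
  (forall k, Qspan l (Re (x k)) /\ Qspan l (Im (x k))) ->
  exists P : {poly rat}, [/\ P != 0, (size P <= (size l + size l).+1)%N &
    \sum_(k < size P) ratr P`_k * x k = 0].
Proof.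
move=> H; set m := (size l + size l)%N.
have /fin_all_exists[c cE] (k : 'I_m.+1) : exists c : 'rV[rat]_m,
    Re (x k) = \sum_i ratr (lsubmx c 0 i) * l`_i /\
    Im (x k) = \sum_i ratr (rsubmx c 0 i) * l`_i.
  have [/Qspan_coord[c cE] /Qspan_coord[d dE]] := H k.
  by exists (row_mx c d); rewrite row_mxKl row_mxKr.
pose A : 'M[rat]_(m.+1, m) := \matrix_k c k.
have kA : kermx A != 0.
  rewrite -mxrank_eq0 mxrank_ker subn_eq0 -ltnNge ltnS; exact: rank_leq_col.
have /rowV0Pn[i0 ri0] := kA.
move=> v0; move: ri0 => /sub_kermxP vA.
pose P := \poly_(k < m.+1) i0 0 (inord k).
have PE (k : 'I_m.+1) : P`_k = i0 0 k by rewrite coef_poly ltn_ord inord_val.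
exists P; split.
- apply: contra v0 => /eqP P0; apply/eqP/rowP => k.
  by rewrite -PE P0 coef0 mxE.
- exact: size_poly.
have -> : \sum_(k < size P) ratr P`_k * x k = \sum_(k < m.+1) ratr P`_k * x k.
  have sP : (size P <= m.+1)%N by exact: size_poly.
  rewrite (big_ord_widen _ (fun k => ratr P`_k * x k) sP) big_mkcond /=.
  apply: eq_bigr => k _; case: ltnP => // kP.
  by rewrite nth_default // rmorph0 mul0r.
have col (j : 'I_m) : \sum_k i0 0 k * c k 0 j = 0.
  have := congr1 (fun M : 'rV_m => M 0 j) vA; rewrite !mxE => E; rewrite -[RHS]E.
  by apply: eq_bigr => k _; rewrite mxE.
have ratrC (q : rat) : ratr q = (ratr q)%:C%C :> F[i] by rewrite fmorph_rat.
apply/eqP; rewrite eq_complex !raddf_sum /=; apply/andP; split; apply/eqP.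
- transitivity (\sum_(k < m.+1) \sum_i ratr (i0 0 k * lsubmx (c k) 0 i) * l`_i).
    apply: eq_bigr => k _; rewrite ratrC PE.
    have [rE _] := cE k; case: (x k) rE => re im /= ->.
    rewrite mul0r subr0 mulr_sumr; apply: eq_bigr => i _.
    by rewrite rmorphM mulrA.
  rewrite exchange_big big1 //= => i _; rewrite -mulr_suml -rmorph_sum.
  by under eq_bigr => k _ do rewrite mxE; rewrite col rmorph0 mul0r.
- transitivity (\sum_(k < m.+1) \sum_i ratr (i0 0 k * rsubmx (c k) 0 i) * l`_i).
    apply: eq_bigr => k _; rewrite ratrC PE.
    have [_ rE] := cE k; case: (x k) rE => re im /= ->.
    rewrite mul0r addr0 mulr_sumr; apply: eq_bigr => i _.
    by rewrite rmorphM mulrA.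
  rewrite exchange_big big1 //= => i _; rewrite -mulr_suml -rmorph_sum.
  by under eq_bigr => k _ do rewrite mxE; rewrite col rmorph0 mul0r.
Qed.

(* With [u = y - i x] and [w = y + i x], the products [w ^+ k * u ^+ (m - k)] avoid inverting [u]
   inside the span, and a linear relation between them divides out to one between powers of [z = w / u]. *)
Lemma unity_root_Qring (F : rcfType) (l : seq F) (x y : F) (z : F[i]) (n : nat) :
  Qring F l -> Qspan l x -> Qspan l y -> y != 0 -> (0 < n)%N -> z ^+ n = 1 ->
  (y +i* (- x))%C * z = (y +i* x)%C ->
  z ^+ ((size l + size l).*2)`! = 1.
Proof.
move=> rl sx sy y0 n0 zn zE; set m := (size l + size l)%N.
have [N prim _] := prim_order_exists n0 zn.
set u := (y +i* (- x))%C in zE; set w := (y +i* x)%C in zE.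
have u0 : u != 0 by rewrite eq_complex /= (negPf y0).
pose S (t : F[i]) := Qspan l (Re t) /\ Qspan l (Im t).
have SM s t : S s -> S t -> S (s * t).
  case: s t => [a b] [c d] [/= sa sb] [/= sc sd]; split=> /=.
    apply: QspanD; first exact: QringM.
    rewrite -mulN1r -(rmorph1 (ratr : rat -> F)) -rmorphN.
    by apply: QspanZ; apply: QringM.
  by apply: QspanD; apply: QringM.
have S1 : S 1 by split; [case: rl | constructor].
have SX s k : S s -> S (s ^+ k).
  by move=> ss; elim: k => [|k IH]; rewrite ?expr0 // exprS; apply: SM.
have Su : S u.
  split=> //=; rewrite -mulN1r -(rmorph1 (ratr : rat -> F)) -rmorphN.
  exact: QspanZ.
have Sw : S w by split.
have [P [P0 sP PE]] := @Qspan_dependent F l (fun k => w ^+ k * u ^+ (m - k))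
  (fun k => SM _ _ (SX w k Sw) (SX u (m - k)%N Su)).
have rP : root (map_poly ratr P) z.
  rewrite rootE horner_coef size_map_poly; apply/eqP.
  apply: (mulIf (expf_neq0 m u0)); rewrite mul0r mulr_suml -[RHS]PE.
  apply: eq_bigr => k _; rewrite coef_map /= -!mulrA; congr (_ * _).
  have km : (k <= m)%N by rewrite -ltnS; apply: leq_trans sP.
  by rewrite -zE exprMn -{1}(subnK km) exprD; ring.
have tN : (totient N <= m)%N.
  rewrite -ltnS; apply: leq_trans sP.
  exact: totient_lt_size_annihilator prim P0 rP.
apply/eqP; rewrite -(prim_order_dvd prim).
by apply: dvdn_fact_totient => //; apply: prim_order_gt0 prim.
Qed.

End RootsOfUnity.

(** * Rational angles with tangent in a number field *)

Module AlgebraicAngles.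
Import all_boot all_order all_algebra all_field complex Rstruct.
Import GRing.Theory Num.Theory RootsOfUnity.
Delimit Scope R_scope with coqR.
Open Scope ring_scope.

Ltac eq_R := lazymatch goal with |- @eq _ ?a ?b => change (@eq R a b) end.

Lemma IZR_intr (c : Z) : exists2 n : int, IZR c = n%:~R & (n = 0 -> c = Z0).
Proof.
suff [n nE] : exists n : int, IZR c = n%:~R.
  by exists n => // n0; apply: eq_IZR_R0; rewrite nE n0.
case: c => [|p|p].
- by exists 0.
- by exists (Posz (nat_of_pos p)); rewrite IZRposE INRE.
- exists (- Posz (nat_of_pos p)).
  by rewrite mulrNz -[_%:~R]INRE -IZRposE -RoppE -opp_IZR.
Qed.

Lemma Zpoly_eval_poly (l : list Z) : exists2 p : {poly int},
  (forall x : R, Zpoly_eval l x = (map_poly intr p).[x]) &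
  ((exists c, In c l /\ c <> Z0) -> p != 0).
Proof.
elim: l => [|c l [p pE p0]].
  by exists 0 => [x|[c [[]]]]; rewrite ?rmorph0 ?horner0.
have [n nE n0] := IZR_intr c.
exists (cons_poly n p).
  move=> x; rewrite -[LHS]/(Rplus (IZR c) (Rmult x (Zpoly_eval l x))) pE.
  rewrite cons_poly_def rmorphD rmorphM /= map_polyX map_polyC !hornerE /=.
  by rewrite RplusE RmultE nE addrC mulrC.
move=> [e [[<-|el] e0]].
  apply/negP => /eqP E; apply: e0; apply: n0.
  by have := congr1 (fun q : {poly int} => q`_0) E; rewrite coef_cons coef0.
have /eqP q0 : p != 0 by apply: p0; exists e.
apply/negP => /eqP E; apply: q0; apply/polyP => i.
by have := congr1 (fun q : {poly int} => q`_i.+1) E; rewrite coef_cons !coef0.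
Qed.

Lemma cis_exp (t : R) (n : nat) :
  ((cos t +i* sin t)%C ^+ n : R[i]) = (cos (INR n * t)%coqR +i* sin (INR n * t)%coqR)%C.
Proof.
elim: n => [|n IH].
  by rewrite expr0 /= Rmult_0_l cos_0 sin_0.
rewrite exprS IH S_INR Rmult_plus_distr_r Rmult_1_l cos_plus sin_plus.
apply/eqP; rewrite eq_complex /= -!RmultE -!RoppE -!RplusE.
by apply/andP; split; apply/eqP; eq_R; ring.
Qed.

Lemma mem_In (a : R) (l : list R) : a \in (l : seq R) -> In a l.
Proof.
elim: l => //= b l IH; rewrite inE => /orP[/eqP->|/IH]; [by left | by right].
Qed.

Lemma In_mem (a : R) (l : list R) : In a l -> a \in (l : seq R).
Proof.
elim: l => //= b l IH [->|/IH]; rewrite inE ?eqxx // => ->; exact: orbT.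
Qed.

(** The double angle is rational in the tangent: if [tan t = x / y], then exp(2it) = (y + ix) / (y -
    ix). It is a root of unity because [t] is a rational multiple of [PI], and its [M]-th power
    being 1 puts [M * t] among the multiples of [PI]. *)
Lemma rational_angle_of_Qring_tan (l : seq R) (x y t : R) (p q : Z) :
  Qring R l -> Qspan l x -> Qspan l y -> y <> 0%coqR ->
  Z.lt 0 q -> t = (IZR p / IZR q * PI)%coqR -> cos t <> 0%coqR ->
  (sin t / cos t = x / y)%coqR ->
  exists z : Z, t = (IZR z / INR ((size l + size l).*2)`! * PI)%coqR.
Proof.
move=> rl sx sy y0 q0 tE ct E.
set M := ((size l + size l).*2)`!.
have MR : INR M <> 0%coqR by apply: not_0_INR => M0; have := fact_gt0 (size l + size l).*2; rewrite -/M M0.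
have qR : (0 < IZR q)%coqR by apply: IZR_lt.
pose z : R[i] := (cos (2 * t)%coqR +i* sin (2 * t)%coqR)%C.
have z1 : z ^+ (Z.to_nat q) = 1.
  rewrite /z cis_exp INR_IZR_INZ Z2Nat.id; last by apply: Z.lt_le_incl.
  have -> : (IZR q * (2 * t) = 2 * IZR p * PI)%coqR by rewrite tE; field; lra.
  have := sin_eq_0_1 (IZR p * PI) (ex_intro _ p erefl) => sp.
  have -> : (2 * IZR p * PI = 2 * (IZR p * PI))%coqR by ring.
  by rewrite cos_2a_sin sin_2a sp !Rmult_0_r !Rmult_0_l Rminus_0_r.
have zE : (y +i* (- x))%C * z = (y +i* x)%C.
  have xE : x = (y * sin t / cos t)%coqR.
    have -> : (y * sin t / cos t = y * (sin t / cos t))%coqR by field.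
    by rewrite E; field.
  have cs := sin2_cos2 t; rewrite /Rsqr in cs.
  apply/eqP; rewrite eq_complex /= -!RmultE -!RoppE -!RplusE cos_2a sin_2a xE.
  apply/andP; split; apply/eqP; eq_R.
    apply: (@eq_trans R _ (y * (sin t * sin t + cos t * cos t))%coqR); last by rewrite cs Rmult_1_r.
    by field.
  have -> : (y * (2 * sin t * cos t) + - (y * sin t / cos t) * (cos t * cos t - sin t * sin t)
    = y * sin t / cos t * (sin t * sin t + cos t * cos t))%coqR by field.
  by rewrite cs Rmult_1_r.
have qn : (0 < Z.to_nat q)%N.
  by apply/ltP; move: q0; clear; lia.
have y0' : y != 0 by apply/eqP.
have := unity_root_Qring R l x y z _ rl sx sy y0' qn z1 zE.
rewrite -/M /z cis_exp => /eqP; rewrite eq_complex /= => /andP[/eqP c1 /eqP s1].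
have : sin (INR M * t) = 0%coqR.
  have h : (INR M * (2 * t) = 2 * (INR M * t))%coqR by ring.
  rewrite h cos_2a_sin in c1.
  have := c1; rewrite -R1E => c2.
  by apply: Rsqr_0_uniq; rewrite /Rsqr; lra.
move=> /sin_eq_0_0[k kE]; exists k.
by apply: (Rmult_eq_reg_l (INR M)) => //; rewrite kE; field.
Qed.

(** Taking all quotients of elements of the ring makes closure under inverses immediate. [M] depends
    only on the number of generators, so the same denominator serves every angle [t]. *)
Theorem algebraic_subfield (l : list R) :
  (forall a, In a l -> is_algebraic a) ->
  exists (S : R -> Prop) (M : nat), M <> O /\
    (forall a, In a l -> S a) /\ S 1%coqR /\
    (forall x y, S x -> S y -> S (x + y)%coqR) /\
    (forall x y, S x -> S y -> S (x * y)%coqR) /\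
    (forall x, S x -> S (- x)%coqR) /\
    (forall x, S x -> S (/ x)%coqR) /\
    (forall (t : R) (p q : Z), Z.lt 0 q -> t = (IZR p / IZR q * PI)%coqR ->
       cos t <> 0%coqR -> S (sin t / cos t)%coqR ->
       exists z : Z, t = (IZR z / INR M * PI)%coqR).
Proof.
move=> H.
have [g rg sg] : exists2 g : seq R, Qring R g & {in (l : seq R), forall a, Qspan g a}.
  apply: Qring_exists => a /mem_In/H[c [c0 ca]].
  have [p pE p0] := Zpoly_eval_poly c.
  by exists p; [apply: p0 | rewrite rootE -pE ca].
have s1 : Qspan g 1%coqR by case: rg.
have sM x y : Qspan g x -> Qspan g y -> Qspan g (x * y)%coqR by rewrite RmultE; apply: QringM.
have sD x y : Qspan g x -> Qspan g y -> Qspan g (x + y)%coqR by rewrite RplusE; apply: QspanD.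
have sN x : Qspan g x -> Qspan g (- x)%coqR.
  rewrite RoppE -mulN1r -(rmorph1 (ratr : rat -> R)) -rmorphN; exact: QspanZ.
exists (fun t => exists x y, [/\ Qspan g x, Qspan g y, y <> 0%coqR & t = (x / y)%coqR]).
exists ((size g + size g).*2)`!.
have R10 : 1%coqR <> 0%coqR :> R by exact: R1_neq_R0.
do !split.
- by apply/eqP; rewrite -lt0n fact_gt0.
- by move=> a /In_mem/sg sa; exists a, 1%coqR; split=> //; field.
- by exists 1%coqR, 1%coqR; split=> //; field.
- move=> _ _ [x [y [sx sy y0 ->]]] [u [v [su sv v0 ->]]].
  exists (x * v + u * y)%coqR, (y * v)%coqR; split; [auto|auto|exact: Rmult_integral_contrapositive_currified | by field].
- move=> _ _ [x [y [sx sy y0 ->]]] [u [v [su sv v0 ->]]].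
  exists (x * u)%coqR, (y * v)%coqR; split; [auto|auto|exact: Rmult_integral_contrapositive_currified | by field].
- move=> _ [x [y [sx sy y0 ->]]].
  by exists (- x)%coqR, y; split; auto; field.
- move=> _ [x [y [sx sy y0 ->]]].
  have [->|x0] := Req_dec x 0%coqR.
    exists 0%coqR, 1%coqR; split; auto; first by constructor.
    by rewrite /Rdiv !Rmult_0_l Rinv_0.
  by exists y, x; split; auto; field.
- move=> t p q q0 tE ct [x [y [sx sy y0 E]]].
  exact: rational_angle_of_Qring_tan rg sx sy y0 q0 tE ct E.
Qed.

End AlgebraicAngles.

(** * The theorem *)

(** Used to pass from finitely many data to finitely many cylinders: one representative is chosen
    for every datum that occurs. *)
Lemma finite_classes {D X : Type} (l : list D) (Rel : D -> X -> Prop) (eqv : X -> X -> Prop) :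
  (forall a x y, Rel a x -> Rel a y -> eqv x y) ->
  exists L : list X, forall x, (exists a, In a l /\ Rel a x) -> exists y, In y L /\ eqv x y.
Proof.
intros H. induction l as [|a l [L HL]].
- exists nil. intros x [a [[] _]].
- destruct (classic (exists y, Rel a y)) as [[y hy]|no].
  + exists (y :: L). intros x [b [[<-|hb] hx]].
    * exists y. split; [now left | now apply (H a)].
    * destruct (HL x) as [z [hz e]]; [now exists b|]. exists z. split; [now right | exact e].
  + exists L. intros x [b [[<-|hb] hx]]; [exfalso; apply no; now exists x|].
    apply HL. now exists b.
Qed.

Theorem theorem4p1 (d : nat) (v : nat -> pt)
  (Hsimple : simple_polygon d v)
  (Hrat : rational_polygon d v)
  (Halg : algebraic_vertices d v) :
  exists L : list (phase -> Prop),
    forall C, lam_stable_cylinder d v C ->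
      exists C', In C' L /\ forall p, C p <-> C' p.
Proof.
destruct (AlgebraicAngles.algebraic_subfield (flat_map (fun i => fst (v i) :: snd (v i) :: nil) (seq 0 d)))
  as [S [M [hM [Sl [S1 [Sadd [Smul [Sopp [Sinv angle]]]]]]]]].
{ intros a ha. apply in_flat_map in ha. destruct ha as [i [hi [<-|[<-|[]]]]];
  apply in_seq in hi; apply Halg; lia. }
assert (Sv : forall i, (i < d)%nat -> S (fst (v i)) /\ S (snd (v i))).
{ intros i hi. split; apply Sl; apply in_flat_map; exists i; (split; [apply in_seq; lia | simpl; auto]). }
(* An angle [z / M * PI] strictly between [- PI / 2] and [PI / 2] has [|z| < M]; the list runs from
   [- M] to [M - 1]. *)
set (zs := map (fun n => (Z.of_nat n - Z.of_nat M)%Z) (seq 0 (2 * M))).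
set (D := list_prod (list_prod (seq 0 d) zs) (list_prod (seq 0 d) (true :: false :: nil))).
(* The data are the side and the angle of a flight, the vertex on its boundary line, and the parity
   of its index, which tells to which side of the flight a positive displacement leads. *)
set (Rel := fun (a : nat * Z * (nat * bool)) (C : phase -> Prop) =>
  let '(i, z, (w, b)) := a in
  exists x k dl, is_periodic_orbit d v 1 x /\ same_set C (cylinder_of d v x) /\
    0 < dl /\ (forall r, 0 <= r < dl -> cylinder_of d v x (displaced d v x r k)) /\
    hit d v x k w = dl /\ side (x k) = i /\ ang (x k) = IZR z / INR M * PI /\
    (-1) ^ k = if b then 1 else -1).
destruct (finite_classes D Rel same_set) as [L HL].
{ intros [[i z] [w b]] C C' [x [k [dl [hx [e [h1 [c1 [t1 [s1 [a1 p1]]]]]]]]]]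
    [x' [k' [dl' [hx' [e' [h1' [c1' [t1' [s1' [a1' p1']]]]]]]]]].
  assert (E : same_set (cylinder_of d v x) (cylinder_of d v x')).
  { apply (cylinder_determined d v Hsimple x x' k k' w dl dl'); auto; congruence. }
  intros p. rewrite (e p), (e' p). apply E. }
exists L. intros C [[x [hx hC]] [[q [hq st]] _]]. apply HL.
pose proof st as [hpo _].
assert (e : same_set C (cylinder_of d v q)).
{ intros p. rewrite hC. apply (cylinder_common d v Hsimple x q (q 0%nat)); auto.
  - apply hC, hq.
  - exists q, 0%nat. split; [|reflexivity]. now apply cyl_rel_refl. }
destruct (cylinder_end d v Hsimple q hpo) as [dl [h1 [c1 [k [w [hw ht]]]]]].
assert (hp : in_phase d (q k)) by apply hpo.
destruct (stable_angles_rational d v Hsimple q Hrat st k) as [p [r [hr ha]]].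
pose proof (in_phase_cos d _ hp) as cpos.
destruct (angle (ang (q k)) p r hr ha ltac:(lra)
  (periodic_tan_in_field d v Hsimple S S1 Sadd Smul Sopp Sinv Sv q hpo k)) as [z hz].
assert (parity : (-1) ^ k = 1 \/ (-1) ^ k = -1).
{ pose proof (pow_m1_sqr k) as sq. assert (((-1) ^ k - 1) * ((-1) ^ k + 1) = 0) by lra.
  apply Rmult_integral in H. destruct H; [left | right]; lra. }
set (b := if Req_dec_T ((-1) ^ k) 1 then true else false).
exists (side (q k), z, (w, b)). split.
- repeat apply in_prod.
  + apply in_seq. destruct hp. lia.
  + destruct hp as [_ [_ [l u]]].
    assert (MR : 0 < INR M) by (apply lt_0_INR; lia). pose proof PI_RGT_0 as pi.
    assert (bz : - INR M < IZR z < INR M).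
    { rewrite hz in l, u. assert (hz' : IZR z = IZR z / INR M * INR M) by (field; lra).
      set (y := IZR z / INR M) in *. assert (-1 < y < 1) by (split; nra). rewrite hz'. split; nra. }
    rewrite INR_IZR_INZ, <- opp_IZR in bz. destruct bz as [b1 b2]. apply lt_IZR in b1, b2.
    apply in_map_iff. exists (Z.to_nat (z + Z.of_nat M)). split; [lia|]. apply in_seq. lia.
  + apply in_seq. lia.
  + destruct b; simpl; auto.
- exists q, k, dl. split; [exact hpo|]. split; [exact e|]. split; [exact h1|]. split; [exact (c1 k)|].
  split; [exact ht|]. split; [reflexivity|]. split; [exact hz|].
  unfold b. destruct (Req_dec_T ((-1) ^ k) 1); [assumption | destruct parity; [contradiction | assumption]].
Qed.
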